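(* Let $c_1,c_2>0$ and let $H_1,H_2\in C^\infty(\mathbb T^n\times\mathbb R^n)$. Assume that there exist $\omega_1,\omega_2>0$ such that for $j=1,2$ $$\lim_{|p|\to+\infty}\left[\omega_j|H_j(x,p)|^2+D_xH_j(x,p)\cdot p-16n\,\omega_jc_j^2|p|^2\right]=+\infty\quad\text{uniformly in }x\in\mathbb T^n.$$ Then there exists a pair of constants $(\overline H_1,\overline H_2)\in\mathbb R^2$ such that the system $$\begin{cases}c_1u_1-c_1u_2+H_1(x,Du_1)=\overline H_1\\-c_2u_1+c_2u_2+H_2(x,Du_2)=\overline H_2\end{cases}\quad\text{in }\mathbb T^n$$ admits a viscosity solution $(u_1,u_2)\in C(\mathbb T^n)^2$.
   Context: $\mathbb T^n=\mathbb R^n/\mathbb Z^n$, $n\ge2$; functions on $\mathbb T^n$ are identified with $\mathbb Z^n$-periodic functions on $\mathbb R^n$. A pair $(u_1,u_2)$ of continuous functions is a viscosity solution of the system if each $u_j$ is a viscosity solution of the $j$-th equation, regarded as a scalar equation for $u_j$ with the other component a given continuous function. *)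

(* Defs.v *)
From HB Require Import structures.
From mathcomp Require Import all_boot all_order all_algebra.
From mathcomp Require Import all_classical all_reals all_analysis.

Set Implicit Arguments.
Unset Strict Implicit.
Unset Printing Implicit Defensive.

Import Order.TTheory GRing.Theory Num.Theory.
Import numFieldNormedType.Exports.

Local Open Scope classical_set_scope.
Local Open Scope ring_scope.

(* The library norm on 'rV[R]_n is the max norm; [enorm] is the Euclidean one. *)
Definition dotp (R : realType) (n : nat) (p q : 'rV[R]_n) : R :=
  \sum_(i < n) p ord0 i * q ord0 i.

Definition enorm (R : realType) (n : nat) (p : 'rV[R]_n) : R :=
  Num.sqrt (dotp p p).

Definition grad (R : realType) (n : nat) (f : 'rV[R]_n -> R) (x : 'rV[R]_n)
    : 'rV[R]_n :=
  \row_(i < n) ('D_(delta_mx ord0 i) f x).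

(* Real-valued functions of class C^k. [V] is meant to be finite-dimensional:
   continuity of all the directional derivatives is then continuity of the
   Frechet differential. *)
Fixpoint classC (R : realType) (V : normedModType R) (k : nat) (f : V -> R)
    : Prop :=
  match k with
  | 0%N => continuous f
  | k'.+1 => (forall x : V, differentiable f x) /\
             (forall v : V, classC k' (fun x : V => 'D_v f x))
  end.

Definition classCinf (R : realType) (V : normedModType R) (f : V -> R) : Prop :=
  forall k : nat, classC k f.

(* Functions on the torus are Z^n-periodic functions on R^n. *)
Definition zperiodic (R : realType) (n : nat) (f : 'rV[R]_n -> R)
    : Prop :=
  forall (x : 'rV[R]_n) (z : 'rV[int]_n),
    f (x + map_mx (intr : int -> R) z) = f x.

Definition smooth_hamiltonian (R : realType) (n : nat)
    (H : 'rV[R]_n -> 'rV[R]_n -> R) : Prop :=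
  (forall p : 'rV[R]_n, zperiodic (fun x => H x p)) /\
  classCinf (fun xp : 'rV[R]_n * 'rV[R]_n => H xp.1 xp.2).

Definition lim_pinfty_unif (R : realType) (n : nat)
    (G : 'rV[R]_n -> 'rV[R]_n -> R) : Prop :=
  forall M : R, exists r : R,
    forall x p : 'rV[R]_n, r < enorm p -> M < G x p.

(* Viscosity solutions of F (x, u, Du) = 0. Test functions need not be
   periodic: the notion is local. *)
Definition visc_subsolution (R : realType) (n : nat)
    (F : 'rV[R]_n -> R -> 'rV[R]_n -> R) (u : 'rV[R]_n -> R) : Prop :=
  forall (phi : 'rV[R]_n -> R) (x0 : 'rV[R]_n), classC 1 phi ->
    (\forall x \near x0, u x - phi x <= u x0 - phi x0) ->
    F x0 (u x0) (grad phi x0) <= 0.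

Definition visc_supersolution (R : realType) (n : nat)
    (F : 'rV[R]_n -> R -> 'rV[R]_n -> R) (u : 'rV[R]_n -> R) : Prop :=
  forall (phi : 'rV[R]_n -> R) (x0 : 'rV[R]_n), classC 1 phi ->
    (\forall x \near x0, u x0 - phi x0 <= u x - phi x) ->
    0 <= F x0 (u x0) (grad phi x0).

Definition visc_solution (R : realType) (n : nat)
    (F : 'rV[R]_n -> R -> 'rV[R]_n -> R) (u : 'rV[R]_n -> R) : Prop :=
  [/\ continuous u, visc_subsolution F u & visc_supersolution F u].

(* In each equation the other component is a given continuous function of x. *)
Definition visc_solution_system (R : realType) (n : nat) (c1 c2 : R)
    (H1 H2 : 'rV[R]_n -> 'rV[R]_n -> R) (Hbar1 Hbar2 : R)
    (u1 u2 : 'rV[R]_n -> R) : Prop :=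
  visc_solution (fun x r p => c1 * r - c1 * u2 x + H1 x p - Hbar1) u1 /\
  visc_solution (fun x r p => - c2 * u1 x + c2 * r + H2 x p - Hbar2) u2.

(* Main.v *)
Require Import Defs.
From mathcomp Require Import all_boot all_order all_algebra.
From mathcomp Require Import all_classical all_reals all_analysis.
From mathcomp Require Import ring lra.
Import Order.TTheory GRing.Theory Num.Theory.
Import numFieldNormedType.Exports.
Local Open Scope classical_set_scope.
Local Open Scope ring_scope.

Set Implicit Arguments.
Unset Strict Implicit.
Unset Printing Implicit Defensive.

(** For a single equation [c * u + H (x, Du) = c * f] with [f] given, let [T f] be
    its maximal subsolution. If [T1] and [T2] are the operators of the two
    equations, then [(u1, u2) = (T1 v, v)] solves the system with constants [0]
    and [- c2 * l] as soon as [T2 (T1 v) = v + l]. So the theorem asks for an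
    additive eigenfunction of [T2 o T1].

    Coercivity. Along a line [x + t *: p] the function [h t = H (x + t *: p, p)]
    satisfies [omega * h ^ 2 + h' > 16 * n * omega * c ^ 2 * |p| ^ 2] when [p] is
    large. If [p] is rational, [h] is periodic, and a periodic function can
    satisfy this only if [|h|] never falls below the threshold
    [4 * sqrt n * c * |p|]: it would cross a lower level upwards only
    ([periodic_riccati]). By density [|H (x, p)| >= 4 * sqrt n * c * |p|] for all
    large [p] ([threshold]), and [H] has a constant sign there because the
    exterior of a ball is connected when [n >= 2] ([sign_constant]). If the sign
    is negative, [u -> - u] reduces to the positive case
    ([solution_operator_reflect]); the two Hamiltonians may have different signs.

    Solution operators. For coercive [H], Perron's method shows that the maximal
    subsolution below a constant supersolution is a viscosity solution
    ([perron_subsolution], [perron_supersolution]). Being defined by maximality,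
    [T] is monotone and commutes with the addition of constants. If [f]
    oscillates by at most [D], then [H (x, Du)] is at most [c * D] up to a
    constant, so [T f] is Lipschitz with constant [D / (4 * sqrt n) + C]
    ([lipschitz_of_test_slopes]), and since the unit cube has diameter [sqrt n],
    [T f] oscillates by at most [D / 4 + C'].

    Eigenfunction. Therefore [T2 o T1] is monotone, commutes with constants,
    contracts oscillations up to a constant and has equi-Lipschitz values.
    Iterating [f -> T ((1 - d) f)] gives approximate eigenfunctions with a common
    Lipschitz bound; a uniform limit of them is an eigenfunction
    ([equilipschitz_limit], [additive_eigenfunction]). *)

(** * Euclidean geometry and differential calculus on row vectors *)

(** A vector [v] is enough to cover one-sided conditions on either side: for
    [V = R] and [v = -1] the condition is on a left neighbourhood. *)
Lemma derive_le0_right {R : realType} {V : normedModType R} (f : V -> R)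
    (x v : V) : derivable f x v ->
  (\forall h \near (0 : R)^'+, f (h *: v + x) <= f x) -> 'D_v f x <= 0.
Proof.
move=> dv fmax; rewrite /derive cvg_at_rightE; last exact: dv.
apply: limr_le.
  by apply/cvg_ex; eexists; apply: cvg_dnbhs_at_right; exact: dv.
near=> h; apply: mulr_ge0_le0; first by rewrite invr_ge0 ltW.
by rewrite subr_le0; near: h.
Unshelve. all: by end_near. Qed.

Section Calculus.
Context {R : realType} {n : nat}.
Implicit Types (x y z p v : 'rV[R]_n) (f g phi psi w : 'rV[R]_n -> R).

Lemma dotpDl x y z : dotp (x + y) z = dotp x z + dotp y z.
Proof.
by rewrite /dotp -big_split; apply: eq_bigr => i _; rewrite mxE mulrDl.
Qed.

Lemma dotpC x y : dotp x y = dotp y x.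
Proof. by apply: eq_bigr => i _; rewrite mulrC. Qed.

Lemma dotpZl a x y : dotp (a *: x) y = a * dotp x y.
Proof. by rewrite /dotp big_distrr /=; apply: eq_bigr => i _; rewrite mxE mulrA. Qed.

Lemma dotpDr x y z : dotp z (x + y) = dotp z x + dotp z y.
Proof. by rewrite dotpC dotpDl !(dotpC z). Qed.

Lemma dotpZr a x y : dotp x (a *: y) = a * dotp x y.
Proof. by rewrite dotpC dotpZl dotpC. Qed.

Lemma dotp_ge0 x : 0 <= dotp x x.
Proof. by apply: sumr_ge0 => i _; rewrite -expr2 sqr_ge0. Qed.

Lemma enorm_ge0 x : 0 <= enorm x.
Proof. exact: sqrtr_ge0. Qed.

Lemma enorm_sqr x : enorm x ^+ 2 = dotp x x.
Proof. by rewrite sqr_sqrtr ?dotp_ge0. Qed.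

Lemma enormZ a x : enorm (a *: x) = `|a| * enorm x.
Proof.
by rewrite /enorm dotpZl dotpZr mulrA -expr2 sqrtrM ?sqr_ge0// sqrtr_sqr.
Qed.

Lemma enormN x : enorm (- x) = enorm x.
Proof. by rewrite -scaleN1r enormZ normrN1 mul1r. Qed.

Lemma enorm0 : enorm (0 : 'rV[R]_n) = 0.
Proof. by rewrite -(scale0r (0 : 'rV[R]_n)) enormZ normr0 mul0r. Qed.

Lemma coord_le_enorm x i : `|x ord0 i| <= enorm x.
Proof.
rewrite -(ler_pXn2r (isT : (0 < 2)%N)) ?nnegrE ?enorm_ge0//.
rewrite enorm_sqr /dotp (bigD1 i)//= real_normK ?num_real// expr2 lerDl.
by apply: sumr_ge0 => j _; rewrite -expr2 sqr_ge0.
Qed.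

Lemma normr_rV_le x (e : R) : 0 <= e -> (forall i, `|x ord0 i| <= e) -> `|x| <= e.
Proof.
move=> e0 xe; rewrite [leLHS]/Num.norm/= mx_normrE; apply/bigmax_leP; split => //.
by move=> [i j] _ /=; rewrite ord1.
Qed.

Lemma coord_le_normr x i : `|x ord0 i| <= `|x|.
Proof.
by rewrite [leRHS]/Num.norm/= mx_normrE; apply/bigmax_geP; right; exists (ord0, i).
Qed.

Lemma normr_le_enorm x : `|x| <= enorm x.
Proof. by apply: normr_rV_le => [|i]; [exact: enorm_ge0|exact: coord_le_enorm]. Qed.

Lemma enorm_le_normr x : enorm x <= Num.sqrt n%:R * `|x|.
Proof.
rewrite -(ler_pXn2r (isT : (0 < 2)%N)) ?nnegrE ?mulr_ge0 ?sqrtr_ge0 ?enorm_ge0//.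
rewrite enorm_sqr exprMn sqr_sqrtr ?ler0n// /dotp.
rewrite mulr_natl -[X in _ *+ X](card_ord n) -sumr_const; apply: ler_sum => i _.
by rewrite -expr2 -real_normK ?num_real// ler_pXn2r ?nnegrE// coord_le_normr.
Qed.

Lemma coord_continuous0 i : continuous (fun x => x ord0 i).
Proof. exact: coord_continuous. Qed.

Lemma dotp_continuous (T : topologicalType) (F G : T -> 'rV[R]_n) :
  continuous F -> continuous G -> continuous (fun t => dotp (F t) (G t)).
Proof.
move=> cF cG; apply: continuous_big; first exact: add_continuous.
move=> i _ t; apply: cvgM.
  exact: (continuous_comp (cF t) (@coord_continuous0 i (F t))).
exact: (continuous_comp (cG t) (@coord_continuous0 i (G t))).
Qed.

Lemma enorm_continuous : continuous (@enorm R n).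
Proof.
move=> x; apply: (@continuous_comp _ _ _ (fun x => dotp x x) Num.sqrt).
  by apply: dotp_continuous; move=> ?; exact: cvg_id.
exact: sqrt_continuous.
Qed.

Lemma derive_grad f x v : differentiable f x -> 'D_v f x = dotp (grad f x) v.
Proof.
move=> df; rewrite deriveE// {1}(row_sum_delta v).
rewrite (linear_sum ('d f x)) /dotp; apply: eq_bigr => i _.
by rewrite linearZ/= mxE deriveE// mulrC.
Qed.

Lemma grad_unique f x z : differentiable f x ->
  (forall v, 'D_v f x = dotp z v) -> grad f x = z.
Proof.
move=> df Df; apply/rowP => i; rewrite mxE Df /dotp (bigD1 i)//= big1 ?addr0.
  by rewrite mxE !eqxx mulr1.
by move=> j ji; rewrite mxE (negbTE ji) andbF mulr0.
Qed.

Lemma derive_local_max f x v : differentiable f x ->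
  (\forall y \near x, f y <= f x) -> 'D_v f x = 0.
Proof.
move=> df fmax; have dv z : derivable f x z by exact: diff_derivable.
have le0 z : 'D_z f x <= 0.
  apply: derive_le0_right => //.
  have cv : (h *: z + x) @[h --> (0:R)^'+] --> x.
    rewrite -[X in _ --> X]add0r -(scale0r z); apply: cvgD; last exact: cvg_cst.
    by apply: cvgZr_tmp; exact: cvg_at_right_filter.
  exact: (cv _ fmax).
apply/le_anti; rewrite le0//= -oppr_le0.
by have := le0 (- v); rewrite !deriveE// linearN.
Qed.

(** Used when a test function touches a function that is itself of class C^1:
    the viscosity inequality is then the classical one. *)
Lemma grad_touching f g x : differentiable f x -> differentiable g x ->
  (\forall y \near x, f y - g y <= f x - g x) -> grad f x = grad g x.
Proof.
move=> df dg fg; apply: grad_unique => // v; rewrite -derive_grad//.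
apply/eqP; rewrite -subr_eq0 -deriveB; [|exact: diff_derivable..].
by apply/eqP; apply: (@derive_local_max (f - g)) => //; exact: differentiableB.
Qed.

Lemma grad_local_max f x : differentiable f x ->
  (\forall y \near x, f y <= f x) -> grad f x = 0.
Proof.
move=> df fx; apply/rowP => i; rewrite !mxE; exact: derive_local_max.
Qed.

Lemma classC1_differentiable f x : classC 1 f -> differentiable f x.
Proof. by case. Qed.

Lemma classC1_continuous f : classC 1 f -> continuous f.
Proof. by case=> df _ x; exact: differentiable_continuous. Qed.

Lemma classC1_grad_continuous f : classC 1 f -> continuous (grad f).
Proof.
case=> df cD x; apply/(@cvgrPdist_le _ _ _ (nbhs x) (nbhs_filter x)) => e e0.
have : \forall y \near x, forall i, `|grad f x ord0 i - grad f y ord0 i| <= e.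
  apply: (@filter_forall _ _ _ _ (nbhs_filter x)) => i.
  have /cvgrPdist_le/(_ e e0) := cD (delta_mx ord0 i) x.
  by apply: filterS => y; rewrite !mxE.
apply: filterS => y h; apply: normr_rV_le => [|i]; first exact: ltW.
by have := h i; rewrite !mxE.
Qed.

Lemma classC1_cst (a : R) : classC 1 (cst a : 'rV[R]_n -> R).
Proof.
split=> [x|v]; first exact: differentiable_cst.
under eq_fun do rewrite derive_cst; exact: cst_continuous.
Qed.

Lemma classC1N f : classC 1 f -> classC 1 (- f).
Proof.
case=> df cD; split=> [x|v]; first exact: differentiableN.
have -> : (fun x => 'D_v (- f) x) = - (fun x => 'D_v f x).
  by apply/funext => x; rewrite deriveN//; exact: diff_derivable.
by move=> x; apply: continuousN; exact: cD.
Qed.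

Lemma classC1D f g : classC 1 f -> classC 1 g -> classC 1 (f + g).
Proof.
move=> [df cf] [dg cg]; split=> [x|v]; first exact: differentiableD.
have -> : (fun x => 'D_v (f + g) x) = (fun x => 'D_v f x) + (fun x => 'D_v g x).
  by apply/funext => x; rewrite deriveD//; exact: diff_derivable.
by move=> x; apply: continuousD; [exact: cf|exact: cg].
Qed.

Lemma gradN f x : differentiable f x -> grad (- f) x = - grad f x.
Proof.
move=> df; apply: grad_unique => [|v]; first exact: differentiableN.
rewrite deriveN ?derive_grad//; last exact: diff_derivable.
by rewrite -[in RHS]scaleN1r dotpZl mulN1r.
Qed.

Lemma gradD f g x : differentiable f x -> differentiable g x ->
  grad (f + g) x = grad f x + grad g x.
Proof.
move=> df dg; apply: grad_unique => [|v]; first exact: differentiableD.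
by rewrite deriveD ?derive_grad ?dotpDl//; exact: diff_derivable.
Qed.

Lemma grad_cst (a : R) x : grad (cst a) x = 0.
Proof. by apply/rowP => i; rewrite !mxE derive_cst. Qed.

Definition sqdist y x : R := dotp (x - y) (x - y).

Lemma sqdist_ge0 y x : 0 <= sqdist y x.
Proof. exact: dotp_ge0. Qed.

Lemma sqdistE y x : sqdist y x = enorm (x - y) ^+ 2.
Proof. by rewrite enorm_sqr. Qed.

Lemma sqdistxx x : sqdist x x = 0.
Proof. by rewrite sqdistE subrr enorm0 expr0n. Qed.

Lemma normr_sqr_le_sqdist y x : `|x - y| ^+ 2 <= sqdist y x.
Proof. by rewrite sqdistE ler_pXn2r ?nnegrE ?enorm_ge0// normr_le_enorm. Qed.

Lemma subr_continuous y : continuous (fun x => x - y).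
Proof.
move=> x; apply: (@cvgB _ _ _ (nbhs x)).
exact: cvg_id.
exact: cvg_cst.
Qed.

Lemma is_derive_coord i x v : is_derive x v (fun z => z ord0 i) (v ord0 i).
Proof.
have /derivable_mxP did : derivable (@id 'rV[R]_n) x v by exact: derivable_id.
have := derive_id x v; rewrite derive_mx; last exact: derivable_id.
move=> /(congr1 (fun M : 'rV[R]_n => M ord0 i)); rewrite mxE => Dc.
exact: DeriveDef (did _ _) Dc.
Qed.

Lemma differentiable_sqdist y x : differentiable (sqdist y) x.
Proof.
have -> : sqdist y =
    \sum_(i < n) (fun z => (z ord0 i - y ord0 i) * (z ord0 i - y ord0 i)).
  apply/funext => z; rewrite /sqdist /dotp fct_sumE.
  by apply: eq_bigr => i _; rewrite !mxE.
apply: differentiable_sum => i.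
by apply: differentiableM; apply: differentiableB => //;
  exact: differentiable_coord.
Qed.

Lemma derive_sqdist y x v : 'D_v (sqdist y) x = dotp (2 *: (x - y)) v.
Proof.
have -> : sqdist y =
    \sum_(i < n) (fun z => (z ord0 i - y ord0 i) * (z ord0 i - y ord0 i)).
  apply/funext => z; rewrite /sqdist /dotp fct_sumE.
  by apply: eq_bigr => i _; rewrite !mxE.
have dc i : is_derive x v (fun z => z ord0 i - y ord0 i) (v ord0 i).
  have := is_derive_coord i x v => dci.
  by rewrite -[X in is_derive _ _ _ X]subr0; exact: is_deriveB.
rewrite derive_val /dotp; apply: eq_bigr => i _.
by rewrite !mxE /GRing.scale/=; ring.
Qed.

Lemma classC1_sqdist y : classC 1 (sqdist y).
Proof.
split=> [x|v]; first exact: differentiable_sqdist.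
under eq_fun do rewrite derive_sqdist dotpZl.
move=> x; apply: (@continuousM _ _ (cst 2) (fun x => dotp (x - y) v)).
  exact: cst_continuous.
apply: (@dotp_continuous _ (fun x => x - y) (cst v)).
  exact: subr_continuous.
exact: cst_continuous.
Qed.

Lemma grad_sqdist y x : grad (sqdist y) x = 2 *: (x - y).
Proof.
by apply: grad_unique => [|v]; [exact: differentiable_sqdist|exact: derive_sqdist].
Qed.

Lemma near_normP (P : 'rV[R]_n -> Prop) x :
  (\forall y \near x, P y) <-> exists2 d, 0 < d & forall y, `|y - x| < d -> P y.
Proof.
split=> [/nbhs_normP[d /= d0 dP]|[d d0 dP]].
  by exists d => // y yx; apply: dP; rewrite /ball_/= distrC.
by apply/nbhs_normP; exists d => //= y; rewrite /ball_/= distrC => /dP.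
Qed.

Lemma continuous_normP f x : {for x, continuous f} <->
  forall e, 0 < e -> exists2 d, 0 < d & forall y, `|y - x| < d -> `|f y - f x| < e.
Proof.
split=> [cf e e0|cf].
  apply/near_normP; have /(@cvgrPdist_lt _ _ _ (nbhs x) (nbhs_filter x))/(_ e e0) := cf.
  by apply: filterS => y; rewrite distrC.
apply/(@cvgrPdist_lt _ _ _ (nbhs x) (nbhs_filter x)) => e /cf /near_normP.
by apply: filterS => y; rewrite distrC.
Qed.

End Calculus.

(** * Lipschitz bounds from bounds on the slopes of test functions *)

Section Lipschitz.
Context {R : realType} {n : nat}.
Implicit Types (x y z p v : 'rV[R]_n) (f g phi psi w : 'rV[R]_n -> R).

Lemma max_on_ball f y (d : R) : 0 <= d -> continuous f ->
  exists2 m, `|m - y| <= d & forall x, `|x - y| <= d -> f x <= f m.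
Proof.
move=> d0 cf; pose A := [set x : 'rV[R]_n | `|x - y| <= d].
have cA : compact A.
  apply: bounded_closed_compact.
    exists (`|y| + d); split; first exact: num_real.
    move=> M yM x /= xd; rewrite (le_trans _ (ltW yM))//.
    by rewrite -[x in `|x|](subrK y) addrC (le_trans (ler_normD _ _))// lerD2l.
  have -> : A = (fun x => `|x - y|) @^-1` [set t | t <= d] by [].
  apply: closed_comp; last exact: closed_le.
  move=> x _; apply: (@continuous_comp _ _ _ (fun x => x - y) Num.norm).
    exact: subr_continuous.
  exact: norm_continuous.
have A0 : A !=set0 by exists y; rewrite /A/= subrr normr0.
have [m mA mmax] := EVT_max_rV A0 cA (continuous_subspaceT cf).
exists m; first by move: mA; rewrite inE.
by move=> x xA; apply: mmax; rewrite inE.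
Qed.

Lemma derive_comp1 (g : R -> R) f x v :
  differentiable f x -> derivable g (f x) 1 ->
  differentiable (g \o f) x /\ 'D_v (g \o f) x = 'D_1 g (f x) * 'D_v f x.
Proof.
move=> df dg; have dg' : differentiable g (f x) by apply/derivable1_diffP.
have dgf : differentiable (g \o f) x by exact: differentiable_comp.
split=> //; rewrite !deriveE// diff_comp//=.
by rewrite !deriv1E//= scale1r; exact: mulrC.
Qed.

(** Smoothing at scale [e] makes the distance to [y] a test function. *)
Definition softdist y (e : R) x : R := Num.sqrt (sqdist y x + e ^+ 2).

Lemma softdist_arg_gt0 y e x : 0 < e -> 0 < sqdist y x + e ^+ 2.
Proof. by move=> e0; rewrite ltr_wpDl ?sqdist_ge0 ?exprn_gt0. Qed.

Lemma softdist_gt0 y e x : 0 < e -> 0 < softdist y e x.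
Proof. by move=> e0; rewrite sqrtr_gt0 softdist_arg_gt0. Qed.

Lemma sqr_softdist y e x : 0 < e -> softdist y e x ^+ 2 = sqdist y x + e ^+ 2.
Proof. by move=> e0; rewrite sqr_sqrtr// ltW// softdist_arg_gt0. Qed.

Lemma softdist_le y e x : 0 < e -> softdist y e x <= enorm (x - y) + e.
Proof.
move=> e0; have N0 := enorm_ge0 (x - y).
rewrite -(ler_pXn2r (isT : (0 < 2)%N)) ?nnegrE ?addr_ge0 ?(ltW e0) ?sqrtr_ge0//.
rewrite sqr_softdist// sqdistE; have := mulr_ge0 N0 (ltW e0); nra.
Qed.

Lemma softdist_ge y e x : 0 < e -> enorm (x - y) <= softdist y e x.
Proof.
move=> e0; rewrite -(ler_pXn2r (isT : (0 < 2)%N)) ?nnegrE ?enorm_ge0 ?sqrtr_ge0//.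
by rewrite sqr_softdist// sqdistE lerDl sqr_ge0.
Qed.

Lemma softdist_self y e : 0 < e -> softdist y e y = e.
Proof.
by move=> e0; rewrite /softdist sqdistxx add0r sqrtr_sqr ger0_norm// ltW.
Qed.

Lemma derive_softdist y e x v : 0 < e ->
  differentiable (softdist y e) x /\
  'D_v (softdist y e) x = dotp ((softdist y e x)^-1 *: (x - y)) v.
Proof.
move=> e0; have sg0 := softdist_arg_gt0 y x e0.
have darg : differentiable (sqdist y + cst (e ^+ 2)) x.
  by apply: differentiableD; [exact: differentiable_sqdist|exact: differentiable_cst].
have [|dc Dc] := @derive_comp1 Num.sqrt (sqdist y + cst (e ^+ 2)) x v darg.
  by have [] := is_derive1_sqrt sg0.
split=> //; rewrite [LHS]Dc (derive_sqrt sg0).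
rewrite deriveD; [|exact/diff_derivable/differentiable_sqdist|
                   exact/diff_derivable/differentiable_cst].
rewrite derive_sqdist derive_cst addr0 !dotpZl invfM /softdist.
by rewrite mulrACA mulVf ?mul1r// pnatr_eq0.
Qed.

Lemma classC1_softdist y e : 0 < e -> classC 1 (softdist y e).
Proof.
move=> e0; split=> [x|v]; first by have [] := derive_softdist y x 0 e0.
have -> : (fun x => 'D_v (softdist y e) x) =
    (fun x => (softdist y e x)^-1 * dotp (x - y) v).
  by apply/funext => x; have [_ ->] := derive_softdist y x v e0; rewrite dotpZl.
move=> x.
apply: (@continuousM _ _ (fun x => (softdist y e x)^-1) (fun x => dotp (x - y) v)).
  apply: continuousV; first by rewrite gt_eqF// softdist_gt0.
  apply: differentiable_continuous; by have [] := derive_softdist y x 0 e0.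
apply: (@dotp_continuous _ _ _ (fun x => x - y) (cst v)).
  exact: subr_continuous.
exact: cst_continuous.
Qed.

Lemma classC1Z (a : R) f : classC 1 f -> classC 1 (a *: f).
Proof.
case=> df cD; split=> [x|v]; first exact: differentiableZ.
have -> : (fun x => 'D_v (a *: f) x) = a *: (fun x => 'D_v f x).
  by apply/funext => x; rewrite deriveZ//; exact: diff_derivable.
by move=> x; apply: (@continuousM _ _ (cst a) (fun x => 'D_v f x));
  [exact: cst_continuous|exact: cD].
Qed.

Lemma gradZ (a : R) f x : differentiable f x -> grad (a *: f) x = a *: grad f x.
Proof.
move=> df; apply: grad_unique => [|v]; first exact: differentiableZ.
by rewrite deriveZ ?derive_grad ?dotpZl//; exact: diff_derivable.
Qed.

(** For [L' > L], the slope of [L' * softdist y e] exceeds [L] except within a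
    distance of order [e] of [y], so the maximum point of
    [w - L' * softdist y e] is that close to [y]; then [e] tends to 0 and [L']
    to [L]. *)
Lemma lipschitz_of_test_slopes w (L B : R) : 0 <= L -> continuous w ->
  (forall x, w x <= B) ->
  (forall phi x0, classC 1 phi ->
     (\forall x \near x0, w x - phi x <= w x0 - phi x0) ->
     enorm (grad phi x0) <= L) ->
  forall x y, w x - w y <= L * enorm (x - y).
Proof.
move=> L0 cw wB slope x y; rewrite leNgt; apply/negP => gap.
set N := enorm (x - y) in gap; have N0 : 0 <= N by exact: enorm_ge0.
pose g := w x - w y - L * N; have g0 : 0 < g by rewrite subr_gt0.
have [s s0 sN] : exists2 s, 0 < s & s * N <= g / 4.
  have N1 : 0 < N + 1 by rewrite ltr_wpDl.
  exists (g / (4 * (N + 1))); first by rewrite divr_gt0// mulr_gt0.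
  have -> : g / 4 = g / (4 * (N + 1)) * (N + 1) by field; lra.
  by rewrite ler_pM2l ?lerDl// divr_gt0// mulr_gt0.
pose L' := L + s; have L'0 : 0 < L' by rewrite ltr_wpDl.
have [d d0 wd] := (continuous_normP w y).1 (cw y) (g / 4) ltac:(lra).
pose e := Num.min (g / (4 * (L' + 1))) (d * s / (L + 1)).
have L1 : 0 < L + 1 by rewrite ltr_wpDl.
have L'1 : 0 < L' + 1 by rewrite addr_gt0.
have e0 : 0 < e.
  by rewrite lt_min; apply/andP; split; apply: divr_gt0 => //; exact: mulr_gt0.
have eL' : L' * e <= g / 4.
  have : e <= g / (4 * (L' + 1)) by rewrite ge_min lexx.
  rewrite ler_pdivlMr ?mulr_gt0//.
  by move: e0 L'0; lra.
have eL : L * e < d * s.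
  have : e <= d * s / (L + 1) by rewrite ge_min lexx orbT.
  rewrite ler_pdivlMr//.
  by move: e0 L0; lra.
pose phi := L' *: softdist y e.
have Cphi : classC 1 phi by apply: classC1Z; exact: classC1_softdist.
(* beyond distance [rho] the function is below its value at [y] *)
pose rho := (B - w y + L' * e) / L'.
have rho0 : 0 <= rho.
  apply: divr_ge0; last exact: ltW.
  by have := wB y; have := mulr_gt0 L'0 e0; lra.
have [m _ mmax] := @max_on_ball (fun z => w z - phi z) y rho rho0
  (fun z => continuousB (cw z) (classC1_continuous Cphi (x := z))).
have gmax z : w z - phi z <= w m - phi m.
  have [zr|zr] := leP `|z - y| rho; first exact: mmax.
  have yr : `|y - y| <= rho by rewrite subrr normr0.
  apply: le_trans (mmax y yr); rewrite /phi.
  rewrite [X in _ - X <= _](_ : _ = L' * softdist y e z)//.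
  rewrite [X in _ <= _ - X](_ : _ = L' * softdist y e y)// softdist_self//.
  have : rho * L' < softdist y e z * L'.
    by rewrite ltr_pM2r// (lt_le_trans zr)// (le_trans (normr_le_enorm _))// softdist_ge.
  rewrite /rho divfK ?gt_eqF// mulrC; have := wB z; lra.
have slm : enorm (grad phi m) <= L.
  by apply: slope => //; near=> z; exact: gmax.
have dm : `|m - y| < d.
  move: slm; rewrite /phi gradZ; last first.
    by apply: classC1_differentiable; exact: classC1_softdist.
  rewrite (@grad_unique _ _ _ _ ((softdist y e m)^-1 *: (m - y))); first last.
  - by move=> v; have [_ ->] := derive_softdist y m v e0.
  - by have [] := derive_softdist y m 0 e0.
  have S0 := softdist_gt0 y m e0; have S2 := sqr_softdist y m e0.
  rewrite !enormZ !gtr0_norm ?invr_gt0// mulrCA ler_pdivrMl// => h.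
  apply: (le_lt_trans (normr_le_enorm _)).
  move: h S2; rewrite sqdistE; set q := enorm _; set S := softdist _ _ _ => h S2.
  have q0 : 0 <= q by exact: enorm_ge0.
  rewrite ltNge; apply/negP => dq.
  have [L'0' SS0 e0' d0' s0'] : [/\ 0 <= L', 0 <= S, 0 <= e, 0 <= d & 0 <= s].
    by split; exact: ltW.
  have h2 : (L' * q) ^+ 2 <= (S * L) ^+ 2.
    by apply: lerXn2r; rewrite ?nnegrE ?mulr_ge0.
  have h3 : (L * e) ^+ 2 < (d * s) ^+ 2.
    by rewrite (ltr_pXn2r (isT : (0 < 2)%N)) ?nnegrE ?mulr_ge0.
  have h4 : (d * s) ^+ 2 <= (q * s) ^+ 2.
    by apply: lerXn2r; rewrite ?nnegrE ?mulr_ge0 ?ler_pM2r.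
  move: h2 h3 h4; rewrite !exprMn S2 /L' => h2 h3 h4.
  have : 0 <= L * s * q ^+ 2 by rewrite !mulr_ge0 ?sqr_ge0// ltW.
  nra.
have := wd m dm; rewrite ltr_norml => /andP[_ wm].
have := gmax x; rewrite /phi.
rewrite [X in _ - X <= _](_ : _ = L' * softdist y e x)//.
rewrite [X in _ <= _ - X](_ : _ = L' * softdist y e m)//.
have : 0 < L' * softdist y e m by rewrite mulr_gt0// softdist_gt0.
have : L' * softdist y e x <= L' * (N + e) by rewrite ler_pM2l// softdist_le.
move: gap wm sN eL'; rewrite /g /L' -/N; lra.
Unshelve. all: by end_near. Qed.

End Lipschitz.

(** * Perron's method *)

Section Perron.
Context {R : realType} {n : nat}.
Implicit Types (x y z p v : 'rV[R]_n) (phi psi u w : 'rV[R]_n -> R).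

Definition discounted (c : R) (h : 'rV[R]_n -> 'rV[R]_n -> R) :=
  fun (x : 'rV[R]_n) (r : R) (p : 'rV[R]_n) => c * r + h x p.

Definition jointly_continuous (h : 'rV[R]_n -> 'rV[R]_n -> R) :=
  continuous (fun xp : 'rV[R]_n * 'rV[R]_n => h xp.1 xp.2).

Lemma jointly_continuous_comp h (g : 'rV[R]_n -> 'rV[R]_n) :
  jointly_continuous h -> continuous g -> continuous (fun x => h x (g x)).
Proof.
move=> ch cg x.
apply: (@continuous_comp _ _ _ (fun x => (x, g x)) (fun xp => h xp.1 xp.2)).
  apply: (@cvg_pair _ _ _ (nbhs x) (nbhs x) (nbhs (g x)) _ _ _ id g); last exact: cg.
  exact: cvg_id.
exact: ch.
Qed.

Lemma near_eq_continuous u w x :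
  (\forall y \near x, w y = u y) -> {for x, continuous u} ->
  {for x, continuous w}.
Proof.
move=> uw /continuous_normP cu; apply/continuous_normP => e /cu /near_normP.
move=> cue; apply/near_normP; near=> y.
by rewrite (nbhs_singleton uw) (near uw)//; near: y.
Unshelve. all: by end_near. Qed.

(** The competitors in Perron's method. For periodic [h] this class is invariant
    under integer translations, which makes its supremum periodic. *)
Definition subsolutions c h (b : R) : set ('rV[R]_n -> R) :=
  [set w | [/\ continuous w, visc_subsolution (discounted c h) w
             & forall x, w x <= b]].

Definition perron c h b x : R := sup [set w x | w in subsolutions c h b].

Section Envelope.
Variables (c : R) (h : 'rV[R]_n -> 'rV[R]_n -> R) (b : R).
Hypotheses (c0 : 0 < c) (ch : jointly_continuous h).
Hypothesis S0 : subsolutions c h b !=set0.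

Let u := perron c h b.
Let S := subsolutions c h b.

Lemma perron_ubound w x : S w -> w x <= u x.
Proof.
move=> Sw; apply: ub_le_sup; last by exists w.
by exists b => _ [v [_ _ vb] <-].
Qed.

Lemma perron_le x (a : R) : (forall w, S w -> w x <= a) -> u x <= a.
Proof.
move=> Sa; apply: ge_sup; first by case: S0 => w Sw; exists (w x); exists w.
by move=> _ [w Sw <-]; exact: Sa.
Qed.

Lemma perron_adherent x (e : R) : 0 < e -> exists2 w, S w & u x - e < w x.
Proof.
move=> e0; have [|_ [w Sw <-] uw] := @sup_adherent R [set w x | w in S] e e0.
- split; first by case: S0 => w Sw; exists (w x); exists w.
  by exists b => _ [v [_ _ vb] <-].
- by exists w.
Qed.

(** If [c * u + h] were positive at the contact point [x0], it would remain so at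
    the maximum point of [w - phi - sqdist x0], for a competitor [w] almost equal
    to [u] at [x0]: the quadratic penalty keeps that maximum point near [x0]. *)
Lemma perron_subsolution : visc_subsolution (discounted c h) u.
Proof.
move=> phi x0 Cphi /near_normP[d1 d10 umax].
rewrite /discounted leNgt; apply/negP => A0.
have [A AE] : exists A, A = c * u x0 + h x0 (grad phi x0) by eexists.
rewrite -AE in A0.
pose psi := phi + sqdist x0.
have Cpsi : classC 1 psi by apply: classC1D => //; exact: classC1_sqdist.
have gpsi : grad psi x0 = grad phi x0.
  rewrite gradD ?grad_sqdist ?subrr ?scaler0 ?addr0//.
    exact: classC1_differentiable.
  exact: differentiable_sqdist.
have ck : continuous (fun x => h x (grad psi x)).
  by apply: jointly_continuous_comp => //; exact: classC1_grad_continuous.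
have [d2 d20 kd] := (continuous_normP _ x0).1 (ck x0) (A / 4) ltac:(lra).
have Ac : 0 < A / (4 * c) by rewrite divr_gt0// mulr_gt0.
have [d3 d30 pd] := (continuous_normP _ x0).1
  (classC1_continuous Cphi (x := x0)) _ Ac.
pose d := Num.min d1 (Num.min d2 d3) / 2.
have [d0 dd1 dd2 dd3] : [/\ 0 < d, d < d1, d < d2 & d < d3].
  have m0 : 0 < Num.min d1 (Num.min d2 d3) by rewrite !lt_min d10 d20 d30.
  have m1 : Num.min d1 (Num.min d2 d3) <= d1 by rewrite ge_min lexx.
  have m2 : Num.min d1 (Num.min d2 d3) <= d2 by rewrite !ge_min lexx orbT.
  have m3 : Num.min d1 (Num.min d2 d3) <= d3 by rewrite !ge_min lexx !orbT.
  by rewrite /d; split; lra.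
clearbody d.
pose eta := Num.min (d ^+ 2) (A / (4 * c)).
have [eta0 etad etaA] : [/\ 0 < eta, eta <= d ^+ 2 & eta <= A / (4 * c)].
  by rewrite lt_min exprn_gt0// !ge_min !lexx orbT.
clearbody eta.
have [w Sw uw] := perron_adherent x0 eta0; have [cw subw _] := Sw.
have [m md mmax] := @max_on_ball _ _ (fun x => w x - psi x) x0 d (ltW d0)
  (fun x => continuousB (cw x) (classC1_continuous Cpsi (x := x))).
have psiE x : psi x = phi x + sqdist x0 x by [].
have xx0 : `|x0 - x0| <= d by rewrite subrr normr0 ltW.
have := mmax _ xx0; rewrite !psiE sqdistxx addr0 => hm.
have um := umax m (le_lt_trans md dd1).
have wum := perron_ubound m Sw.
have q0 := sqdist_ge0 x0 m.
have qd : sqdist x0 m < d ^+ 2.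
  by move: uw wum um hm; lra.
have mid : `|m - x0| < d.
  rewrite -(ltr_pXn2r (isT : (0 < 2)%N)) ?nnegrE ?(ltW d0)//.
  exact: le_lt_trans (normr_sqr_le_sqdist _ _) qd.
have wmax : \forall x \near m, w x - psi x <= w m - psi m.
  apply/near_normP; exists (d - `|m - x0|); first by rewrite subr_gt0.
  move=> x xm; apply: mmax.
  have -> : x - x0 = (x - m) + (m - x0) by rewrite addrA subrK.
  by apply: le_trans (ler_normD _ _) _; lra.
have := subw _ _ Cpsi wmax; rewrite /discounted.
have := kd m (le_lt_trans md dd2); rewrite ltr_norml gpsi => /andP[k1 _].
have := pd m (le_lt_trans md dd3); rewrite ltr_norml => /andP[p1 _].
have wm : u x0 - 2 * (A / (4 * c)) < w m by move: hm uw p1 q0 etaA; lra.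
have cA : c * (A / (4 * c)) = A / 4 by field; rewrite gt_eqF.
have : c * (u x0 - 2 * (A / (4 * c))) < c * w m by rewrite ltr_pM2l.
by move: k1; lra.
Qed.

Hypothesis cu : continuous u.
Hypothesis obstacle : forall x, 0 <= c * b + h x 0.

(** Where the supersolution inequality fails, a test function can be raised
    slightly above [u] while remaining a strict classical subsolution, which
    contradicts the maximality of [u]. Where [u] touches the obstacle [b] there is
    no room to raise it, but there [b] is itself a supersolution. *)
Lemma perron_supersolution : visc_supersolution (discounted c h) u.
Proof.
move=> phi x0 Cphi /near_normP[d1 d10 umin].
rewrite /discounted leNgt; apply/negP => A0.
have ub x : u x <= b by apply: perron_le => w [_ _].
have [ub0|bu0] := ltP (u x0) b; last first.
  (* at a contact point with the obstacle, [phi] has a local maximum *)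
  have {bu0}ub0 : u x0 = b by apply/le_anti; rewrite ub bu0.
  have g0 : grad phi x0 = 0.
    apply: grad_local_max; first exact: classC1_differentiable.
    apply/near_normP; exists d1 => // y /umin; have := ub y; rewrite ub0; lra.
  by move: A0; rewrite g0 ub0 ltNge obstacle.
have [A AE] : exists A, - A = c * u x0 + h x0 (grad phi x0).
  by exists (- (c * u x0 + h x0 (grad phi x0))); rewrite opprK.
rewrite -AE oppr_lt0 in A0.
have Ac : 0 < A / (4 * c) by rewrite divr_gt0// mulr_gt0.
have cA : c * (A / (4 * c)) = A / 4 by field; rewrite gt_eqF.
have [a [a0 aA ab]] : exists a, [/\ 0 < a, a <= A / (4 * c) & a <= (b - u x0) / 2].
  exists (Num.min (A / (4 * c)) ((b - u x0) / 2)).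
  by rewrite lt_min Ac divr_gt0 ?subr_gt0// !ge_min !lexx orbT.
have Cq := classC1N (classC1_sqdist x0).
have Cpq := classC1D Cphi Cq.
have gpsi : grad (phi - sqdist x0) x0 = grad phi x0.
  rewrite gradD; [|exact: classC1_differentiable..].
  rewrite gradN; last exact: differentiable_sqdist.
  by rewrite grad_sqdist subrr scaler0 subr0.
have ck : continuous (fun x => h x (grad (phi - sqdist x0) x)).
  by apply: jointly_continuous_comp => //; exact: classC1_grad_continuous.
have [d2 d20 kd] := (continuous_normP _ x0).1 (ck x0) (A / 4) ltac:(lra).
have [d3 d30 pd] := (continuous_normP _ x0).1
  (classC1_continuous Cphi (x := x0)) _ a0.
have [d [d0 dd1 dd2 dd3]] : exists d, [/\ 0 < d, d <= d1, d <= d2 & d <= d3].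
  exists (Num.min d1 (Num.min d2 d3)).
  by rewrite !lt_min d10 d20 d30 !ge_min !lexx !orbT.
have [eta [eta0 etad etaA]] :
    exists eta, [/\ 0 < eta, eta <= d ^+ 2 / 8 & eta <= a].
  exists (Num.min (d ^+ 2 / 8) a).
  by rewrite lt_min a0 divr_gt0 ?exprn_gt0// !ge_min !lexx orbT.
(* the bump: it exceeds [u] at [x0] but not beyond distance [d / 2] *)
pose psi := phi - sqdist x0 + cst (u x0 - phi x0 + eta).
have Cpsi : classC 1 psi by apply: classC1D => //; exact: classC1_cst.
have psiE x : psi x = phi x - sqdist x0 x + (u x0 - phi x0 + eta) by [].
have gradpsi x : grad psi x = grad (phi - sqdist x0) x.
  have dpq := classC1_differentiable x Cpq.
  by rewrite [LHS](gradD dpq (differentiable_cst _ _)) grad_cst addr0.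
have psi_strict x : `|x - x0| < d -> c * psi x + h x (grad psi x) < 0.
  move=> xd; rewrite gradpsi psiE.
  have := kd x (lt_le_trans xd dd2); rewrite ltr_norml gpsi => /andP[_ k1].
  have := pd x (lt_le_trans xd dd3); rewrite ltr_norml => /andP[_ p1].
  have q0 := sqdist_ge0 x0 x.
  have : phi x - sqdist x0 x + (u x0 - phi x0 + eta) < u x0 + 2 * (A / (4 * c)).
    by lra.
  by rewrite -(ltr_pM2l c0); lra.
have psi_b x : `|x - x0| < d -> psi x <= b.
  move=> xd; rewrite psiE.
  have := pd x (lt_le_trans xd dd3); rewrite ltr_norml => /andP[_ p1].
  by have := sqdist_ge0 x0 x; lra.
have psi_far x : `|x - x0| < d -> d / 2 < `|x - x0| -> psi x <= u x.
  move=> xd dx; rewrite psiE; have := umin x (lt_le_trans xd dd1).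
  have := normr_sqr_le_sqdist x0 x.
  have : (d / 2) ^+ 2 < `|x - x0| ^+ 2.
    by rewrite (ltr_pXn2r (isT : (0 < 2)%N)) ?nnegrE// divr_ge0// ltW.
  by rewrite expr_div_n; lra.
pose w x := if `|x - x0| < d then Num.max (u x) (psi x) else u x.
have uw x : u x <= w x by rewrite /w; case: ifP => // _; rewrite le_max lexx.
have w_near x : `|x - x0| < d -> \forall y \near x, w y = Num.max (u y) (psi y).
  move=> xd; apply/near_normP; exists (d - `|x - x0|); first by rewrite subr_gt0.
  move=> y yx; rewrite /w ifT//.
  have -> : y - x0 = (y - x) + (x - x0) by rewrite addrA subrK.
  by apply: le_lt_trans (ler_normD _ _) _; lra.
have w_far x : d <= `|x - x0| -> \forall y \near x, w y = u y.
  move=> xd; apply/near_normP; exists (d / 2); first by rewrite divr_gt0.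
  move=> y yx; rewrite /w; case: ifP => // yd; apply/max_idPl; apply: psi_far => //.
  have : `|x - x0| <= `|y - x| + `|y - x0|.
    have -> : x - x0 = (x - y) + (y - x0) by rewrite addrA subrK.
    by rewrite (distrC y x) ler_normD.
  by lra.
have cw : continuous w.
  move=> x; have [xd|xd] := ltP `|x - x0| d.
    apply: (near_eq_continuous (w_near x xd)).
    apply: (@continuous_max _ _ u psi); first exact: cu.
    exact: classC1_continuous.
  by apply: (near_eq_continuous (w_far x xd)); exact: cu.
have Sw : S w.
  split=> //; last first.
    by move=> x; rewrite /w; case: ifP => // xd; rewrite ge_max ub psi_b.
  move=> xi y Cxi ymax.
  have [wu|/eqP wu] := eqVneq (w y) (u y).
    rewrite wu; apply: (perron_subsolution Cxi).
    by apply: filterS ymax => z; rewrite wu; have := uw z; lra.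
  have yd : `|y - x0| < d by move: wu; rewrite /w; case: ifP.
  have wy : w y = psi y.
    by move: wu; rewrite /w yd; case: leP.
  rewrite /discounted wy -(grad_touching _ _ (f := psi)).
  - exact/ltW/psi_strict.
  - exact: classC1_differentiable.
  - exact: classC1_differentiable.
  near=> z; have : w z - xi z <= w y - xi y by near: z.
  have : w z = Num.max (u z) (psi z) by near: z; exact: w_near.
  by rewrite wy => ->; have : psi z <= Num.max (u z) (psi z);
     [rewrite le_max lexx orbT|lra].
have := perron_ubound x0 Sw; rewrite -/u leNgt => /negP; apply.
have x0d : `|x0 - x0| < d by rewrite subrr normr0.
by rewrite /w x0d lt_max psiE sqdistxx; apply/orP; right; lra.
Unshelve. all: by end_near. Qed.

End Envelope.
End Perron.

(** * The solution operator of the discounted equation *)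

Section Periodic.
Context {R : realType} {n : nat}.
Implicit Types (x y : 'rV[R]_n) (f : 'rV[R]_n -> R) (z : 'rV[int]_n).

Local Notation "z %:V" := (map_mx (intr : int -> R) z) (at level 2).

Lemma unit_cube_translate x :
  exists z, forall i, 0 <= (x + z%:V) ord0 i <= 1.
Proof.
exists (\row_i (- Num.floor (x ord0 i))) => i; rewrite !mxE rmorphN/=.
have /andP[h1 h2] := Num.Theory.floor_itv (x ord0 i).
by move: h2; rewrite intrD; lra.
Qed.

Lemma zperiodic_bounded f : continuous f -> zperiodic f ->
  exists2 M, 0 <= M & forall x, `|f x| <= M.
Proof.
move=> cf pf.
have [a _ amax] := @max_on_ball _ _ (fun x => `|f x|) 0 1 ler01
  (fun x => continuous_comp (cf x) (@norm_continuous _ R^o (f x))).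
exists `|f a| => // x; have [z zx] := unit_cube_translate x.
rewrite -(pf x z); apply: amax; rewrite subr0; apply: normr_rV_le => // i.
by have /andP[h0 h1] := zx i; rewrite ger0_norm.
Qed.

Lemma zperiodic_osc f (L D : R) : 0 <= L -> zperiodic f ->
  (forall x y, f x - f y <= L * enorm (x - y)) -> L * Num.sqrt n%:R <= D ->
  forall x y, f x - f y <= D.
Proof.
move=> L0 pf Lf LD x y.
have [z zx] := unit_cube_translate x; have [z' zy] := unit_cube_translate y.
rewrite -(pf x z) -(pf y z'); apply: le_trans (Lf _ _) (le_trans _ LD).
rewrite ler_wpM2l//; apply: le_trans (enorm_le_normr _) _.
rewrite -[leRHS]mulr1 ler_wpM2l ?sqrtr_ge0//; apply: normr_rV_le => // i.
have := zx i; have := zy i; rewrite !mxE ler_norml.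
by move=> /andP[? ?] /andP[? ?]; apply/andP; split; lra.
Qed.

Lemma lipschitz_continuous f (L : R) : 0 <= L ->
  (forall x y, f x - f y <= L * enorm (x - y)) -> continuous f.
Proof.
move=> L0 Lf x; apply/continuous_normP => e e0.
have K0 : 0 < L * Num.sqrt n%:R + 1.
  by rewrite ltr_wpDl// mulr_ge0// sqrtr_ge0.
exists (e / (L * Num.sqrt n%:R + 1)); first exact: divr_gt0.
move=> y; rewrite ltr_pdivlMr// => yx.
suff : `|f y - f x| <= L * enorm (y - x).
  move=> /le_lt_trans; apply; apply: le_lt_trans _ yx.
  have := enorm_le_normr (y - x); have := normr_ge0 (y - x) => h1 h2.
  have : L * enorm (y - x) <= L * (Num.sqrt n%:R * `|y - x|) by rewrite ler_wpM2l.
  by lra.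
rewrite ler_norml; have := Lf y x; have := Lf x y.
by rewrite -(enormN (x - y)) opprB => ? ?; apply/andP; split; lra.
Qed.

Lemma classC1_translate f y : classC 1 f -> classC 1 (fun x => f (x + y)).
Proof.
case=> df cD; split=> [x|v].
  by apply: (@differentiable_comp _ _ _ _ (fun x => x + y)) => //.
have -> : (fun x => 'D_v (fun x => f (x + y)) x) = (fun x => 'D_v f (x + y)).
  apply/funext => x; rewrite /derive/=.
  by under eq_fun do rewrite -addrA.
move=> x; apply: (@continuous_comp _ _ _ (fun x => x + y) (fun x => 'D_v f x)).
  by rewrite -[y]opprK; exact: subr_continuous.
exact: cD.
Qed.

Lemma grad_translate f x y : grad (fun x => f (x + y)) x = grad f (x + y).
Proof.
apply/rowP => i; rewrite !mxE /derive/=.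
by under eq_fun do rewrite -addrA.
Qed.

End Periodic.

Section Solver.
Context {R : realType} {n : nat}.
Implicit Types (x y p : 'rV[R]_n) (f g w phi : 'rV[R]_n -> R).
Implicit Types (H : 'rV[R]_n -> 'rV[R]_n -> R).

(** [T f] solves [c * u + H (x, Du) = c * f]. The second clause, with [k] of
    either sign, contains monotonicity, nonexpansiveness in the sup norm and
    equivariance under addition of constants. *)
Definition solution_operator (c G : R) H
    (T : ('rV[R]_n -> R) -> 'rV[R]_n -> R) : Prop :=
  [/\ forall f, continuous f -> zperiodic f -> zperiodic (T f) /\
        visc_solution (discounted c (fun x p => H x p - c * f x)) (T f),
      forall f g (k : R), continuous f -> zperiodic f ->
        continuous g -> zperiodic g ->
        (forall x, f x <= g x + k) -> forall x, T f x <= T g x + k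
    & exists2 C, 0 <= C & forall f (D : R), continuous f -> zperiodic f ->
        (forall x y, f x - f y <= D) ->
        forall x y, T f x - T f y <= (D / G + C) * enorm (x - y)].

Definition coercive (c G : R) H : Prop :=
  exists r : R, forall x p, r < enorm p -> G * c * enorm p <= H x p.

Section Coercive.
Variables (c G : R) (H : 'rV[R]_n -> 'rV[R]_n -> R) (K r : R).
Hypotheses (c0 : 0 < c) (G0 : 0 < G).
Hypotheses (cH : jointly_continuous H) (pH : forall p, zperiodic (fun x => H x p)).
Hypotheses (r0 : 0 <= r).
Hypothesis Hr : forall x p, r < enorm p -> G * c * enorm p <= H x p.
Hypotheses (K0 : 0 <= K) (HK : forall x, `|H x 0| <= c * K).

Let h f x p := H x p - c * f x.
Let supf f : R := sup (range f).
Let inff f : R := inf (range f).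
Let S f := subsolutions c (h f) (supf f + K).
Let T f := perron c (h f) (supf f + K).

Let ch f : continuous f -> jointly_continuous (h f).
Proof.
move=> cf xp.
apply: (@continuousB _ _ _ (fun xp : 'rV[R]_n * 'rV[R]_n => H xp.1 xp.2)
  (fun xp => c * f xp.1)); first exact: cH.
apply: (@continuousM _ _ (cst c) (fun xp : 'rV[R]_n * 'rV[R]_n => f xp.1)).
  exact: cst_continuous.
apply: (@continuous_comp _ _ _ (fun xp : 'rV[R]_n * 'rV[R]_n => xp.1) f).
  exact: cvg_fst.
exact: cf.
Qed.

Let le_supf f x : continuous f -> zperiodic f -> f x <= supf f.
Proof.
move=> cf pf; have [M _ fM] := zperiodic_bounded cf pf.
apply: ub_le_sup; last by exists x.
by exists M => _ [y _ <-]; exact: le_trans (ler_norm _) (fM y).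
Qed.

Let inff_le f x : continuous f -> zperiodic f -> inff f <= f x.
Proof.
move=> cf pf; have [M _ fM] := zperiodic_bounded cf pf.
apply: ge_inf; last by exists x.
by exists (- M) => _ [y _ <-]; have := fM y; rewrite ler_norml => /andP[].
Qed.

(** Raising a competitor to a constant subsolution bounds it from below, and
    thereby bounds [H (x, Dphi)] for its test functions [phi]. *)
Let max_floor f w : continuous f -> zperiodic f ->
  S f w -> S f (w \max cst (inff f - K)).
Proof.
move=> cf pf [cw sw bw]; set m := inff f - K.
have mb : m <= supf f + K.
  by rewrite /m; have := inff_le 0 cf pf; have := le_supf 0 cf pf; have := K0; lra.
split; first by move=> x; apply: (@continuous_max _ _ w (cst m));
  [exact: cw|exact: cst_continuous].
- move=> phi x0 Cphi; rewrite /=; have [wm|mw] := leP (w x0) m => xmax.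
    have g0 : grad phi x0 = 0.
      rewrite -(@grad_touching _ _ (cst m) phi x0); first exact: grad_cst.
      + exact: differentiable_cst.
      + exact: classC1_differentiable.
      apply: filterS xmax => x /= xm.
      by rewrite (le_trans _ xm)// lerD2r le_max lexx orbT.
    rewrite g0 /discounted /h.
    have := inff_le x0 cf pf; have := HK x0; rewrite ler_norml => /andP[_ H0] fi.
    have : c * (m + K) <= c * f x0 by rewrite ler_pM2l// /m; lra.
    by rewrite mulrDr; lra.
  apply: sw => //; apply: filterS xmax => x /= xm.
  by rewrite (le_trans _ xm)// lerD2r le_max lexx.
- by move=> x; rewrite /= ge_max bw mb.
Qed.

Let S_neq0 f : continuous f -> zperiodic f -> S f !=set0.
Proof.
move=> cf pf; exists (cst (inff f - K)).
split; first exact: cst_continuous.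
- move=> phi x0 Cphi xmax.
  have -> : grad phi x0 = 0.
    rewrite -(@grad_touching _ _ (cst (inff f - K)) phi x0) //.
    + exact: grad_cst.
    + exact: classC1_differentiable.
  have := HK x0; rewrite ler_norml => /andP[_ H0].
  have : c * (inff f - K) <= c * (f x0 - K).
    by rewrite ler_pM2l// lerD2r inff_le.
  by rewrite /discounted /h mulrBr; lra.
- move=> x; have := inff_le x cf pf; have := le_supf x cf pf; have := K0.
  by rewrite /=; lra.
Qed.

Let lipschitz_floor f w (D : R) : continuous f -> zperiodic f ->
  (forall x y, f x - f y <= D) ->
  S f w -> (forall x, inff f - K <= w x) ->
  forall x y, w x - w y <= (D / G + (r + K / G)) * enorm (x - y).
Proof.
move=> cf pf fD [cw sw bw] mw.
have D0 : 0 <= D by have := fD 0 0; rewrite subrr.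
have DG : 0 <= D / G by rewrite divr_ge0// ltW.
have KG : 0 <= K / G by rewrite divr_ge0// ltW.
apply: (lipschitz_of_test_slopes _ cw bw); first by rewrite !addr_ge0.
move=> phi x0 Cphi xmax; have := sw _ _ Cphi xmax.
rewrite /discounted /h; set p := grad phi x0 => hp.
have [pr|pr] := leP (enorm p) r; first by lra.
have Hp := @Hr x0 p pr.
have fm : f x0 - D <= inff f.
  apply: lb_le_inf; first by exists (f x0); exists x0.
  by move=> _ [y _ <-]; have := fD x0 y; lra.
have cle : c * (G * enorm p) <= c * (D + K).
  have : c * (f x0 - w x0) <= c * (D + K).
    by rewrite ler_pM2l//; have := mw x0; lra.
  by rewrite mulrBr; lra.
suff : enorm p <= (D + K) / G by have := r0; rewrite mulrDl; lra.
by rewrite ler_pdivlMr// mulrC -(ler_pM2l c0).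
Qed.

Let T_lipschitz f (D : R) : continuous f -> zperiodic f ->
  (forall x y, f x - f y <= D) ->
  forall x y, T f x - T f y <= (D / G + (r + K / G)) * enorm (x - y).
Proof.
move=> cf pf fD x y; rewrite lerBlDr; apply: (perron_le (S_neq0 cf pf)) => w Sw.
have Smw := max_floor cf pf Sw.
have /= mm := lipschitz_floor cf pf fD Smw _ x y.
have {mm} := mm ltac:(by move=> z; rewrite /= le_max lexx orbT).
have /= := perron_ubound y Smw; rewrite -/(T f).
by have : w x <= Num.max (w x) (inff f - K);
  [rewrite le_max lexx|lra].
Qed.

Let T_continuous f : continuous f -> zperiodic f -> continuous (T f).
Proof.
move=> cf pf; have [M M0 fM] := zperiodic_bounded cf pf.
have fD x y : f x - f y <= 2 * M.
  have := fM x; have := fM y; rewrite !ler_norml => /andP[? ?] /andP[? ?]; lra.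
apply: lipschitz_continuous (T_lipschitz cf pf fD).
by rewrite !addr_ge0// divr_ge0// ?mulr_ge0// ltW.
Qed.

Let T_periodic f : continuous f -> zperiodic f -> zperiodic (T f).
Proof.
move=> cf pf.
have T_le x z : T f (x + map_mx (intr : int -> R) z) <= T f x.
  apply: (perron_le (S_neq0 cf pf)) => w [cw sw bw].
  apply: (perron_ubound (w := fun y => w (y + map_mx intr z))).
  split=> //.
    move=> y; apply: (@continuous_comp _ _ _ (fun y => y + _) w); last exact: cw.
    by rewrite -[map_mx _ _]opprK; exact: subr_continuous.
  move=> phi y Cphi ymax.
  set a := map_mx intr z in ymax *.
  have := sw (fun y => phi (y + - a)) (y + a) (classC1_translate (- a) Cphi).
  rewrite grad_translate addrK /discounted /h (pH _ y) (pf y); apply.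
  move/near_normP: ymax => [d d0 dmax]; apply/near_normP; exists d => // t ty.
  have := dmax (t - a); rewrite subrK; apply.
  by rewrite -addrA -opprD (addrC a).
move=> x z; apply/le_anti; rewrite T_le/=.
have := T_le (x + map_mx intr z) (- z).
suff -> : x + map_mx intr z + map_mx (intr : int -> R) (- z) = x by [].
by apply/rowP => i; rewrite !mxE rmorphN addrK.
Qed.

(** Monotonicity holds because [T f] is a maximal subsolution: subtracting [k]
    maps the competitors for [f] to competitors for [g]. *)
Lemma solution_operator_of_bounds : solution_operator c G H T.
Proof.
split.
- move=> f cf pf; split; first exact: T_periodic.
  split; first exact: T_continuous.
    exact: (perron_subsolution c0 (ch cf) (S_neq0 cf pf)).
  apply: (perron_supersolution c0 (ch cf) (S_neq0 cf pf)).
    exact: T_continuous.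
  move=> x; have := HK x; rewrite ler_norml => /andP[H0 _].
  have : c * f x <= c * supf f by rewrite ler_pM2l// le_supf.
  by rewrite /h mulrDr; lra.
- move=> f g k cf pf cg pg fg x.
  apply: (perron_le (S_neq0 cf pf)) => w [cw sw bw].
  rewrite -lerBlDr; apply: (perron_ubound (w := fun y => w y - k)).
  split.
  + by move=> y; apply: (@continuousB _ _ _ w (cst k));
      [exact: cw|exact: cst_continuous].
  + move=> phi y Cphi ymax.
    have : \forall t \near y, w t - phi t <= w y - phi y.
      by apply: filterS ymax => t; lra.
    move=> /(sw _ _ Cphi); rewrite /discounted /h.
    have : c * f y <= c * (g y + k) by rewrite ler_pM2l.
    by rewrite mulrDr mulrBr; lra.
  + move=> y; have : supf f <= supf g + k.
      apply: ge_sup; first by exists (f 0); exists 0.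
      by move=> _ [t _ <-]; apply: le_trans (fg t) _; rewrite lerD2r le_supf.
    by have := bw y; lra.
- exists (r + K / G); last by move=> *; exact: T_lipschitz.
  by rewrite addr_ge0// divr_ge0// ltW.
Qed.

End Coercive.

Lemma solution_operator_coercive c G H : 0 < c -> 0 < G ->
  jointly_continuous H -> (forall p, zperiodic (fun x => H x p)) ->
  coercive c G H -> exists T, solution_operator c G H T.
Proof.
move=> c0 G0 cH pH [r Hr].
have cH0 : continuous (fun x => H x 0).
  by apply: (@jointly_continuous_comp _ _ H (cst 0)) => //; exact: cst_continuous.
have [M M0 HM] := zperiodic_bounded cH0 (pH 0).
have K0 : 0 <= M / c by rewrite divr_ge0// ltW.
eexists; apply: (@solution_operator_of_bounds c G H (M / c) (Num.max 0 r)) => //.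
- by rewrite le_max lexx.
- by move=> x p; rewrite gt_max => /andP[_]; exact: Hr.
- by move=> x; rewrite mulrC divfK ?gt_eqF.
Qed.

(** The substitution [u -> - u] turns [H] into [- H (x, - p)] and exchanges
    subsolutions with supersolutions. *)
Lemma solution_operator_reflect c G H T :
  solution_operator c G (fun x p => - H x (- p)) T ->
  solution_operator c G H (fun f => - T (- f)).
Proof.
have Ncont f : continuous f -> continuous (- f).
  by move=> cf x; apply: continuousN; exact: cf.
have Nper f : zperiodic f -> zperiodic (- f).
  by move=> pf x z; rewrite fctE/= pf.
move=> [Tsol Tmono [C C0 TC]]; split.
- move=> f cf pf; have [pT [cT subT supT]] := Tsol _ (Ncont _ cf) (Nper _ pf).
  split; first exact: Nper.
  split; first exact: Ncont.
  + move=> phi x Cphi xmax.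
    have := supT (- phi) x (classC1N Cphi).
    rewrite gradN; last exact: classC1_differentiable.
    rewrite /discounted !opprK => h.
    suff : 0 <= c * T (- f) x + (- H x (grad phi x) - c * (- f) x).
      by rewrite !fctE/=; lra.
    by apply: h; apply: filterS xmax => y; rewrite !fctE/=; lra.
  + move=> phi x Cphi xmin.
    have := subT (- phi) x (classC1N Cphi).
    rewrite gradN; last exact: classC1_differentiable.
    rewrite /discounted !opprK => h.
    suff : c * T (- f) x + (- H x (grad phi x) - c * (- f) x) <= 0.
      by rewrite !fctE/=; lra.
    by apply: h; apply: filterS xmin => y; rewrite !fctE/=; lra.
- move=> f g k cf pf cg pg fg x.
  have Tgf : T (- g) x <= T (- f) x + k; last first.
    by suff : - T (- f) x <= - T (- g) x + k by []; lra.
  apply: Tmono; [exact: Ncont|exact: Nper|exact: Ncont|exact: Nper|].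
  by move=> y; suff : - g y <= - f y + k by []; have := fg y; lra.
- exists C => // f D cf pf fD x y.
  suff : - T (- f) x - - T (- f) y <= (D / G + C) * enorm (x - y) by [].
  rewrite -(enormN (x - y)) opprB opprK addrC.
  apply: TC; [exact: Ncont|exact: Nper|].
  move=> s t; suff : - f s - - f t <= D by [].
  by rewrite opprK addrC.
Qed.

End Solver.

(** * Coercivity from a Riccati inequality along closed orbits *)

Section Riccati.
Context {R : realType}.
Implicit Types (g : R -> R).

(** Between an up-crossing at [0] and one at [N] there must be a down-crossing:
    the last point of [[t0, t1]] where [g] is nonnegative. *)
Lemma no_two_upcrossings g (N : R) : 0 < N ->
  (forall t, derivable g t 1) -> g 0 = 0 -> g N = 0 ->
  (forall t, g t = 0 -> 0 < 'D_1 g t) -> False.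
Proof.
move=> N0 dg g0 gN gpos.
have cg : continuous g.
  by move=> t; apply: differentiable_continuous; apply/derivable1_diffP.
have [t0 [t00 t0N gt0]] : exists t0, [/\ 0 < t0, t0 < N & 0 < g t0].
  apply/not_existsP => nex; have := gpos _ g0; rewrite ltNge => /negP; apply.
  apply: derive_le0_right => //; near=> h; rewrite g0 [h *: 1]mulr1 addr0.
  by rewrite leNgt; apply/negP => gh; apply: (nex h); split.
have [t1 [t01 t1N gt1]] : exists t1, [/\ t0 < t1, t1 < N & g t1 < 0].
  apply/not_existsP => nex; have := gpos _ gN; rewrite ltNge => /negP; apply.
  have -> : 'D_1 g N = 'D_(-1) (- g) N.
    have dN : differentiable g N by apply/derivable1_diffP.
    rewrite deriveN; last exact: diff_derivable.
    by rewrite !deriveE// linearN opprK.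
  apply: derive_le0_right.
    by apply: derivableN; apply: diff_derivable; apply/derivable1_diffP.
  near=> h; rewrite [h *: -1]mulrN1 addrC.
  suff : - g (N - h) <= - g N by [].
  rewrite gN oppr0 oppr_le0 leNgt; apply/negP => gh; apply: (nex (N - h)); split => //.
    by rewrite ltrBrDr -ltrBrDl; near: h; apply: nbhs_right_lt; rewrite subr_gt0.
  by rewrite ltrBlDr ltrDl.
pose S := `[t0, t1]%classic `&` [set t | 0 <= g t].
have cS : compact S.
  apply: compact_closedI; first exact: segment_compact.
  apply: (@preimage_closed _ _ g [set y | 0 <= y]); last exact: closed_ge.
  by move=> t _; exact: cg.
have S0 : S !=set0.
  by exists t0; split => /=; [rewrite in_itv/= lexx ltW|exact: ltW].
have [s] := compact_EVT_max S0 cS (continuous_subspaceT (fun t => @cvg_id _ (nbhs t))).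
rewrite inE => -[/=]; rewrite in_itv/= => /andP[t0s st1] gs smax.
have {}st1 : s < t1.
  by rewrite lt_neqAle st1 andbT; apply/eqP => st; move: gs; rewrite st leNgt gt1.
have neg t : s < t -> t <= t1 -> g t < 0.
  move=> ts tt1; rewrite ltNge; apply/negP => gt.
  have St : t \in S.
    by rewrite inE; split => //=; rewrite in_itv/= tt1 andbT (le_trans t0s (ltW ts)).
  by have := smax t St; rewrite leNgt ts.
have near_neg : \forall t \near s^'+, g t < 0.
  by near=> t; apply: neg => //; near: t; exact: nbhs_right_le.
have gs0 : g s = 0.
  apply/le_anti; rewrite gs andbT.
  have cgs : g t @[t --> s^'+] --> g s by apply: cvg_at_right_filter; exact: cg.
  rewrite -(cvg_lim _ cgs)//; apply: limr_le; first by apply/cvg_ex; exists (g s).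
  by apply: filterS near_neg => t /ltW.
have := gpos s gs0; rewrite ltNge => /negP; apply; apply: derive_le0_right => //.
near=> h; rewrite [h *: 1]mulr1 gs0 ltW// neg//.
  by rewrite ltrDr.
by rewrite -lerBrDr; near: h; apply: nbhs_right_le; rewrite subr_gt0.
Unshelve. all: by end_near. Qed.

(** If [|h 0|] were smaller than the Riccati threshold, [h] could cross the
    level [h 0] only upwards, although it takes that value again at [N]. *)
Lemma periodic_riccati (h : R -> R) (N a K : R) : 0 < N -> 0 < a ->
  (forall t, derivable h t 1) -> h N = h 0 ->
  (forall t, K < a * h t ^+ 2 + 'D_1 h t) -> K <= a * h 0 ^+ 2.
Proof.
move=> N0 a0 dh hN ric; rewrite leNgt; apply/negP => hK.
apply: (@no_two_upcrossings (h - cst (h 0)) N) => //.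
- by move=> t; apply: derivableB.
- by rewrite fctE/= subrr.
- by rewrite fctE/= hN subrr.
- move=> t /eqP; rewrite fctE/= subr_eq0 => /eqP ht.
  by rewrite deriveB// derive_cst subr0; have := ric t; rewrite ht /=; lra.
Qed.

End Riccati.

Section Coercivity.
Context {R : realType} {n : nat}.
Implicit Types (x y p q : 'rV[R]_n).

Lemma derive_line (f : 'rV[R]_n -> R) x p (t : R) : differentiable f (x + t *: p) ->
  derivable (fun t : R => f (x + t *: p)) t 1 /\
  'D_1 (fun t : R => f (x + t *: p)) t = 'D_p f (x + t *: p).
Proof.
move=> dif; have : derivable f (x + t *: p) p by exact: diff_derivable.
rewrite /derivable /derive/=.
have E (h : R) : f (x + (h *: (1 : R^o) + t) *: p) = f (h *: p + (x + t *: p)).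
  by rewrite [h *: 1]mulr1 scalerDl addrCA.
move=> df; split; last by under eq_fun do rewrite E.
by under eq_fun do rewrite E.
Qed.

(** When [N *: p] is an integer vector the orbit [x + t *: p] closes up on the
    torus, and [f] is periodic along it. *)
Lemma closed_orbit_lower_bound (f : 'rV[R]_n -> R) (a K : R) x p (N : nat)
    (z : 'rV[int]_n) : 0 < a -> zperiodic f -> (forall y, differentiable f y) ->
  (0 < N)%N -> N%:R *: p = map_mx (intr : int -> R) z ->
  (forall y, K < a * f y ^+ 2 + 'D_p f y) -> K <= a * f x ^+ 2.
Proof.
move=> a0 pf df N0 Np ric.
have := @periodic_riccati R (fun t => f (x + t *: p)) N%:R a K.
rewrite scale0r addr0; apply => //; first by rewrite ltr0n.
- by move=> t; have [] := @derive_line f x p t (df _).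
- by rewrite Np pf.
- by move=> t; have [_ ->] := @derive_line f x p t (df _).
Qed.

Lemma rational_dense p (e : R) : 0 < e ->
  exists q (N : nat) (z : 'rV[int]_n),
    [/\ `|q - p| < e, (0 < N)%N & N%:R *: q = map_mx (intr : int -> R) z].
Proof.
move=> e0; have e2 : 0 < e / 2 by lra.
pose N := (Num.truncn (e / 2)^-1).+1.
have N0 : 0 < N%:R :> R by rewrite ltr0n.
have Ne : N%:R^-1 <= e / 2.
  rewrite -[leRHS]invrK lef_pV2 ?posrE ?invr_gt0//; apply: ltW.
  by have /andP[] := Num.Theory.truncn_itv (ltW (etrans (invr_gt0 _) e2)).
exists (\row_i ((Num.floor (N%:R * p ord0 i))%:~R / N%:R)), N.
exists (\row_i Num.floor (N%:R * p ord0 i)); split => //; last first.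
  by apply/rowP => i; rewrite !mxE mulrC divfK// gt_eqF.
apply: le_lt_trans (_ : e / 2 < e); last by lra.
apply: normr_rV_le => [|i]; first exact: ltW.
apply: le_trans Ne; rewrite !mxE distrC.
have /andP[h1 h2] := Num.Theory.floor_itv (N%:R * p ord0 i).
move: h1 h2; set k := Num.floor _ => h1 h2.
have -> : p ord0 i = (N%:R * p ord0 i) / N%:R by rewrite mulrC mulKf// gt_eqF.
rewrite -mulrBl normrM (gtr0_norm (x := N%:R^-1)) ?invr_gt0//.
rewrite -[leRHS]mul1r ler_pM2r ?invr_gt0// ger0_norm ?subr_ge0//.
by move: h2; rewrite intrD; lra.
Qed.

Section Threshold.
Variables (H : 'rV[R]_n -> 'rV[R]_n -> R) (a k r : R).
Hypotheses (a0 : 0 < a) (k0 : 0 < k) (r0 : 0 <= r).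
Hypotheses (cH : jointly_continuous H) (pH : forall p, zperiodic (fun x => H x p)).
Hypothesis dH : forall x p, differentiable (fun y => H y p) x.
Hypothesis ric : forall x p, r < enorm p ->
  a * (k * enorm p) ^+ 2 < a * H x p ^+ 2 + 'D_p (fun y => H y p) x.

(** Orbits are closed only for rational [p], but the inequality passes to the
    limit. *)
Lemma threshold x p : r < enorm p -> k * enorm p <= `|H x p|.
Proof.
move=> rp; rewrite leNgt; apply/negP => small.
pose gap q := (k * enorm q - `|H x q|).
have cgap : continuous gap.
  move=> q; apply: (@continuousB _ _ _ (fun q => k * enorm q) (fun q => `|H x q|)).
    apply: (@continuousM _ _ (cst k) (@enorm R n)); first exact: cst_continuous.
    exact: enorm_continuous.
  apply: (@continuous_comp _ _ _ (fun q => H x q) Num.norm); last exact: norm_continuous.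
  apply: (@continuous_comp _ _ _ (fun q => (x, q)) (fun xp => H xp.1 xp.2));
    last exact: cH.
  apply: (@cvg_pair _ _ _ (nbhs q) (nbhs x) (nbhs q) _ _ _ (cst x) id).
    exact: cvg_cst.
  exact: cvg_id.
have gap0 : 0 < gap p by rewrite subr_gt0.
have rp0 : 0 < enorm p - r by rewrite subr_gt0.
have [d1 d10 gapd] := (continuous_normP gap p).1 (cgap p) _ gap0.
have [d2 d20 enormd] := (continuous_normP _ p).1 (enorm_continuous (x := p)) _ rp0.
have m0 : 0 < Num.min d1 d2 by rewrite lt_min d10.
have [q [N [z [qp N0 Nq]]]] := rational_dense p m0.
move: qp; rewrite lt_min => /andP[/gapd gq /enormd eq].
have {}gq : 0 < gap q by move: gq; rewrite ltr_norml => /andP[+ _]; lra.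
have {}eq : r < enorm q by move: eq; rewrite ltr_norml => /andP[+ _]; lra.
have := @closed_orbit_lower_bound (fun y => H y q) a _ x q N z a0 (pH q)
  (fun y => dH y q) N0 Nq (fun y => ric y eq).
rewrite ler_pM2l// leNgt => /negP; apply.
rewrite -[H x q ^+ 2]real_normK ?num_real//.
rewrite (ltr_pXn2r (isT : (0 < 2)%N)) ?nnegrE ?normr_ge0 ?mulr_ge0 ?enorm_ge0 ?(ltW k0)//.
by rewrite -subr_gt0.
Qed.

Let nonzero x p : r < enorm p -> H x p != 0.
Proof.
move=> rp; have := threshold x rp; rewrite -normr_gt0; apply: lt_le_trans.
by rewrite mulr_gt0// (le_lt_trans r0).
Qed.

Let sign_segment x p y q :
  (forall t : R, 0 <= t <= 1 -> r < enorm (p + t *: (q - p))) ->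
  (0 < H x p) = (0 < H y q).
Proof.
move=> seg; pose g (t : R) := H (x + t *: (y - x)) (p + t *: (q - p)).
have g0 : g 0 = H x p by rewrite /g !scale0r !addr0.
have g1 : g 1 = H y q by rewrite /g !scale1r ![_ + (_ - _)]addrC !subrK.
have cl (u v : 'rV[R]_n) : continuous (fun t : R => u + t *: v).
  move=> t; apply: (@cvgD _ _ _ (nbhs t)); first exact: cvg_cst.
  by apply: (@cvgZr_tmp _ _ _ (nbhs t)); exact: cvg_id.
pose path (t : R) : 'rV[R]_n * 'rV[R]_n := (x + t *: (y - x), p + t *: (q - p)).
have cpath : continuous path.
  move=> t; apply: (@cvg_pair _ _ _ (nbhs t) (nbhs (x + t *: (y - x)))
    (nbhs (p + t *: (q - p)))); exact: cl.
have cg : continuous g.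
  move=> t; apply: (@continuous_comp _ _ _ path
    (fun xp : 'rV[R]_n * 'rV[R]_n => H xp.1 xp.2)); [exact: cpath|exact: cH].
have gn0 t : 0 <= t <= 1 -> g t != 0 by move=> t01; apply: nonzero; exact: seg.
have noc : ~~ (Num.min (g 0) (g 1) <= 0 <= Num.max (g 0) (g 1)).
  apply/negP => h.
  have [t] := IVT ler01 (continuous_subspaceT cg) h.
  by rewrite in_itv/= => /gn0/eqP.
have n0 : g 0 != 0 by apply: gn0; rewrite lexx ler01.
have n1 : g 1 != 0 by apply: gn0; rewrite lexx ler01.
rewrite -g0 -g1.
move: noc n0 n1; rewrite ge_min le_max.
by case: (ltgtP (g 0) 0); case: (ltgtP (g 1) 0).
Qed.

Hypothesis n2 : (2 <= n)%N.
Let i0 : 'I_n := Ordinal (ltn_trans (ltn0Sn 0) n2).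
Let i1 : 'I_n := Ordinal n2.
Let e0 : 'rV[R]_n := delta_mx ord0 i0.
Let e1 : 'rV[R]_n := delta_mx ord0 i1.

(** In dimension at least two the exterior of a ball is connected: push [p]
    outwards along [e1], then go straight to a point far away on the [e0] axis. *)
Let sign_far x p y (L : R) : r < enorm p -> 2 * r + enorm p + 1 <= L ->
  (0 < H x p) = (0 < H y (L *: e0)).
Proof.
move=> rp pL; have rr := r0.
have ep := enorm_ge0 p.
pose s : R := if 0 <= p ord0 i1 then L else - L.
have sL : `|p ord0 i1 + s| = `|p ord0 i1| + L.
  rewrite /s; case: ifPn => [h|]; first by rewrite !ger0_norm//; lra.
  by rewrite -ltNge => h; rewrite !ltr0_norm//; lra.
have sp : 0 <= s * p ord0 i1.
  rewrite /s; case: ifPn => [h|]; first by rewrite mulr_ge0//; lra.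
  by rewrite -ltNge => h; rewrite mulr_le0//; lra.
clearbody s.
have dote1 v : dotp v e1 = v ord0 i1.
  rewrite /dotp (bigD1 i1)//= big1 ?addr0 ?mxE ?eqxx ?mulr1// => j ji.
  by rewrite mxE (negbTE ji) andbF mulr0.
rewrite (sign_segment x y (q := p + s *: e1)); last first.
  move=> t /andP[t0 t1]; apply: lt_le_trans rp _.
  rewrite -(ler_pXn2r (isT : (0 < 2)%N)) ?nnegrE ?enorm_ge0// !enorm_sqr.
  rewrite [p + s *: e1 - p]addrC addKr.
  set v := t *: _; rewrite dotpDl !dotpDr (dotpC v p) /v !(dotpZl, dotpZr) !dote1.
  rewrite mxE !eqxx/=; have : 0 <= t * (s * p ord0 i1) by rewrite mulr_ge0.
  have : 0 <= (t * s) ^+ 2 by rewrite sqr_ge0.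
  by rewrite expr2; lra.
apply: sign_segment => t /andP[t0 t1].
set v := _ + _; have i10 : (i1 == i0) = false by [].
have v1 : v ord0 i1 = (1 - t) * (p ord0 i1 + s).
  by rewrite !mxE !eqxx i10/=; ring.
have v0 : v ord0 i0 = (1 - t) * p ord0 i0 + t * L.
  by rewrite !mxE !eqxx eq_sym i10/=; ring.
have [th|th] := leP t (1 / 2).
  apply: lt_le_trans (coord_le_enorm v i1); rewrite v1 normrM sL.
  rewrite ger0_norm; last by lra.
  have := normr_ge0 (p ord0 i1) => pi.
  have : (1 / 2) * L <= (1 - t) * (`|p ord0 i1| + L) by apply: ler_pM; lra.
  by lra.
apply: lt_le_trans (coord_le_enorm v i0); rewrite v0.
apply: lt_le_trans (ler_norm _).
have := coord_le_enorm p i0; rewrite ler_norml => /andP[p1 p2].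
have : (1 - t) * (- enorm p) <= (1 - t) * p ord0 i0 by apply: ler_wpM2l; lra.
have : (1 - t) * enorm p <= 1 / 2 * enorm p by apply: ler_wpM2r; lra.
have : (1 / 2) * L <= t * L by apply: ler_wpM2r; lra.
by rewrite mulrN; lra.
Qed.

Lemma sign_constant x p y q : r < enorm p -> r < enorm q ->
  (0 < H x p) = (0 < H y q).
Proof.
move=> rp rq; pose L := 2 * r + enorm p + enorm q + 1.
have := enorm_ge0 p; have := enorm_ge0 q => q0 p0.
rewrite (@sign_far x p 0 L) ?(@sign_far y q 0 L)//; rewrite /L; lra.
Qed.

End Threshold.
End Coercivity.

(** * Additive eigenfunctions of monotone operators *)

Section Eigenfunction.
Context {R : realType} {n : nat}.
Implicit Types (x y : 'rV[R]_n) (f g v w : 'rV[R]_n -> R).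

Definition torus_function f : Prop := continuous f /\ zperiodic f.

Definition lipschitz_with (L : R) f : Prop :=
  forall x y, f x - f y <= L * enorm (x - y).

(** Indexed by a finite type, so that the neighbourhood conditions at all grid
    points can be intersected. *)
Definition grid (N : nat) (g : {ffun 'I_n -> 'I_N.+1}) : 'rV[R]_n :=
  \row_i ((g i)%:R / N%:R).

Lemma grid_approx (N : nat) x : (0 < N)%N ->
  exists (g : {ffun 'I_n -> 'I_N.+1}) (z : 'rV[int]_n),
    enorm (x + map_mx (intr : int -> R) z - grid g) <= Num.sqrt n%:R / N%:R.
Proof.
move=> N0; have N0' : 0 < N%:R :> R by rewrite ltr0n.
have [z zx] := unit_cube_translate x.
pose t i := (x + map_mx (intr : int -> R) z) ord0 i.
exists [ffun i => inord (Num.truncn (N%:R * t i))], z.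
apply: le_trans (enorm_le_normr _) _; rewrite ler_wpM2l ?sqrtr_ge0//.
apply: normr_rV_le => [|i]; first by rewrite invr_ge0 ltW.
have /andP[t0 t1] := zx i; rewrite -/(t i) in t0 t1.
have Nt0 : 0 <= N%:R * t i by rewrite mulr_ge0// ltW.
have /andP[h1 h2] := Num.Theory.truncn_itv Nt0.
rewrite mxE -/(t i) !mxE ffunE inordK; last first.
  rewrite ltnS -(ler_nat R); apply: le_trans h1 _.
  by rewrite -[leRHS]mulr1 ler_pM2l.
have -> : t i = (N%:R * t i) / N%:R by rewrite mulrC mulKf// gt_eqF.
move: h1 h2; rewrite [N%:R * (_ / _)]mulrC divfK ?gt_eqF//.
set k := Num.truncn _ => h1 h2.
rewrite -mulrBl normrM (gtr0_norm (x := N%:R^-1)) ?invr_gt0//.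
rewrite -[leRHS]mul1r ler_pM2r ?invr_gt0// ger0_norm ?subr_ge0//.
by move: h2; rewrite -addn1 natrD; lra.
Qed.

Lemma ultra_fmap (X Y : Type) (f : X -> Y) (U : set_system X) :
  UltraFilter U -> UltraFilter (f @ U).
Proof.
move=> UU; split; first exact: fmap_proper_filter.
move=> G GG UG; apply/seteqP; split=> // A GA.
have [//|UnA] := in_ultra_setVsetC (f @^-1` A) UU.
by have [y []] := filter_ex (filterI GA (UG (~` A) UnA)).
Qed.

(** Equi-Lipschitz periodic functions vanishing at the origin have a pointwise
    limit along an ultrafilter, and the convergence is uniform because it is
    uniform on finite grids. *)
Lemma equilipschitz_limit (w : nat -> 'rV[R]_n -> R) (L : R) : 0 <= L ->
  (forall k, zperiodic (w k)) -> (forall k, lipschitz_with L (w k)) ->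
  (forall k, w k 0 = 0) ->
  exists v, [/\ zperiodic v, lipschitz_with L v
    & forall (e : R) (m : nat), 0 < e ->
        exists k, (m <= k)%N /\ forall x, `|w k x - v x| <= e].
Proof.
move=> L0 pw Lw w0; pose B := L * Num.sqrt n%:R.
have wB k x : `|w k x| <= B.
  have osc := zperiodic_osc L0 (pw k) (Lw k) (lexx B).
  have := osc x 0; have := osc 0 x; rewrite w0 ler_norml => h1 h2.
  by apply/andP; split; lra.
have [U [UU ooU]] := ultraFilterLemma eventually_filter.
have lim_ex x : exists l : R, w k x @[k --> U] --> l.
  have := @segment_compact R (- B) B; rewrite compact_ultra.
  move=> /(_ (w k x @[k --> U])) []; first exact: ultra_fmap.
    apply: (@filterS _ U _ setT) => [k _ /=|]; last exact: filterT.
    by rewrite in_itv/= -ler_norml.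
  by move=> l [_ ?]; exists l.
have [v wv] := choice lim_ex.
have wv_near x (e : R) : 0 < e -> \forall k \near U, `|w k x - v x| <= e.
  move=> e0; have /(@cvgrPdist_le _ _ _ U)/(_ e e0) := wv x.
  by apply: filterS => k; rewrite distrC.
have Lv : lipschitz_with L v.
  move=> x y; apply/ler_addgt0Pl => e e0; have e2 : 0 < e / 2 by lra.
  have [k [xk yk]] := filter_ex (filterI (wv_near x _ e2) (wv_near y _ e2)).
  move: xk yk; have := Lw k x y; rewrite /= !ler_norml.
  by move=> h /andP[? ?] /andP[? ?]; lra.
have pv : zperiodic v.
  move=> x z; apply/eqP; rewrite -subr_eq0 -normr_le0; apply/ler_addgt0Pl => e e0.
  have e2 : 0 < e / 2 by lra.
  have [k [xk yk]] := filter_ex (filterI (wv_near x _ e2)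
    (wv_near (x + map_mx (intr : int -> R) z) _ e2)).
  move: xk yk; rewrite /= pw /= addr0 !ler_norml => /andP[? ?] /andP[? ?].
  by apply/andP; split; lra.
exists v; split=> // e m e0.
pose N := (Num.truncn (3 * B / e)).+1.
have N0 : 0 < N%:R :> R by rewrite ltr0n.
have BN : B / N%:R <= e / 3.
  have B0 : 0 <= B by rewrite mulr_ge0 ?sqrtr_ge0.
  have Be0 : 0 <= 3 * B / e by rewrite divr_ge0 ?mulr_ge0// ltW.
  have /andP[_] := Num.Theory.truncn_itv Be0.
  by rewrite -/N => /ltW; rewrite ler_pdivrMr// ler_pdivrMr//; lra.
have e3 : 0 < e / 3 by lra.
have grid_near : \forall k \near U, forall s,
    `|w k (@grid N s) - v (grid s)| <= e / 3.
  by apply: filter_forall => s; exact: wv_near.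
have tail : \forall k \near U, (m <= k)%N by apply: ooU; exists m.
have [k [gk mk]] := filter_ex (filterI grid_near tail).
exists k; split => // x.
have [g [z xg]] := @grid_approx N x isT.
rewrite -(pw k x z) -(pv x z); set y := x + _ in xg *.
have dist_le f : lipschitz_with L f -> `|f y - f (grid g)| <= e / 3.
  move=> Lf; apply: le_trans (_ : L * enorm (y - grid g) <= _); last first.
    by apply: le_trans BN; rewrite /B -mulrA ler_wpM2l.
  rewrite ler_norml; have := Lf y (grid g); have := Lf (grid g) y.
  by rewrite -(enormN (grid g - y)) opprB => ? ?; apply/andP; split; lra.
have := dist_le _ (Lw k); have := dist_le _ Lv; have := gk g.
rewrite !ler_norml => /andP[? ?] /andP[? ?] /andP[? ?].
by apply/andP; split; lra.
Qed.

Section Operator.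
Variable T : ('rV[R]_n -> R) -> 'rV[R]_n -> R.
Variable C : R.
Hypothesis T_torus : forall f, torus_function f -> torus_function (T f).
Hypothesis T_mono : forall f g (k : R), torus_function f -> torus_function g ->
  (forall x, f x <= g x + k) -> forall x, T f x <= T g x + k.
Hypothesis C0 : 0 <= C.
Hypothesis T_osc : forall f (D : R), torus_function f ->
  (forall x y, f x - f y <= D) -> forall x y, T f x - T f y <= D / 2 + C.
Hypothesis T_lipschitz : forall D : R, exists2 L, 0 <= L &
  forall f, torus_function f -> (forall x y, f x - f y <= D) ->
    lipschitz_with L (T f).

Lemma T_nonexpansive f g (e : R) : torus_function f -> torus_function g ->
  (forall x, `|f x - g x| <= e) -> forall x, `|T f x - T g x| <= e.
Proof.
move=> tf tg fg x; rewrite ler_norml; apply/andP; split.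
  suff : T g x <= T f x + e by lra.
  by apply: T_mono => // y; have := fg y; rewrite ler_norml => /andP[? _]; lra.
suff : T f x <= T g x + e by lra.
by apply: T_mono => // y; have := fg y; rewrite ler_norml => /andP[_ ?]; lra.
Qed.

Lemma torus_function_affine f (a b : R) :
  torus_function f -> torus_function (fun x => a * f x + b).
Proof.
move=> [cf pf]; split; last by move=> x z; rewrite pf.
move=> x; apply: (@continuousD _ _ _ (fun x => a * f x) (cst b)).
  by apply: (@continuousM _ _ (cst a) f); [exact: cst_continuous|exact: cf].
exact: cst_continuous.
Qed.

(** The iterates of the contraction [f -> T ((1 - d) f)]; the summand [0] gives
    its argument the form of [torus_function_affine]. *)
Fixpoint damped (d : R) (m : nat) : 'rV[R]_n -> R :=
  if m is m'.+1 then T (fun x => (1 - d) * damped d m' x + 0) else cst 0.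

Section Damped.
Variable d : R.
Hypothesis d01 : 0 < d < 1.

Lemma damped_torus m : torus_function (damped d m).
Proof.
elim: m => [|m IH]; first by split; [exact: cst_continuous|].
by apply: T_torus; exact: torus_function_affine.
Qed.

Lemma damped_osc m x y :
  (1 - d) * damped d m x + 0 - ((1 - d) * damped d m y + 0) <= 2 * C.
Proof.
have /andP[d0 d1] := d01; have c0 := C0.
suff h : damped d m x - damped d m y <= 2 * C.
  have : (1 - d) * (damped d m x - damped d m y) <= (1 - d) * (2 * C).
    by rewrite ler_pM2l//; lra.
  have : 0 <= d * C by rewrite mulr_ge0// ltW.
  by lra.
elim: m x y => [|m IH] x y /=; first by lra.
have -> : 2 * C = 2 * C / 2 + C by lra.
apply: T_osc => [|s t]; first exact/torus_function_affine/damped_torus.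
have : (1 - d) * (damped d m s - damped d m t) <= (1 - d) * (2 * C).
  by rewrite ler_pM2l ?IH//; lra.
have : 0 <= d * C by rewrite mulr_ge0// ltW.
by lra.
Qed.

Lemma damped_contraction : exists B : R, forall m x,
  `|damped d m.+1 x - damped d m x| <= B * (1 - d) ^+ m.
Proof.
have /andP[d0 d1] := d01.
have [c1 p1] := damped_torus 1; have [B B0 fB] := zperiodic_bounded c1 p1.
exists B; elim=> [|m IH] x; first by rewrite expr0 mulr1 /= subr0; exact: fB.
apply: (T_nonexpansive (f := fun x => (1 - d) * damped d m.+1 x + 0)
  (g := fun x => (1 - d) * damped d m x + 0)).
- exact/torus_function_affine/damped_torus.
- exact/torus_function_affine/damped_torus.
move=> y; rewrite !addr0 -mulrBr normrM gtr0_norm ?subr_gt0//.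
by rewrite exprS mulrCA ler_pM2l ?subr_gt0.
Qed.

End Damped.

(** Successive iterates [g] of the damped contraction get within [d] of each
    other, while their oscillation stays below [2 * C] whatever [d] is. Hence, up
    to an additive constant, undoing the damping costs only [2 * C * d]. *)
Lemma approximate_eigenfunction (e : R) : 0 < e ->
  exists w l, [/\ torus_function w, w 0 = 0,
    exists2 f, torus_function f /\ (forall x y, f x - f y <= 2 * C)
             & w = fun x => T f x - T f 0
    & forall x, `|T w x - w x - l| <= e].
Proof.
move=> e0; have c0 := C0; pose D := 2 * C.
have D1 : 0 < D + 1 by rewrite /D; lra.
pose d := Num.min (1 / 2) (e / (D + 1)).
have d0 : 0 < d by rewrite lt_min !divr_gt0.
have d2 : d <= 1 / 2 by rewrite ge_min lexx.
have dD : d * (D + 1) <= e by rewrite -ler_pdivlMr// ge_min lexx orbT.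
have d01 : 0 < d < 1 by rewrite d0; lra.
clearbody d.
have [B Bm] := damped_contraction d01.
have [m mB] : exists m, B * (1 - d) ^+ m.+1 <= d.
  have z1 : `|1 - d| < 1 by rewrite ger0_norm; lra.
  have /(@cvgrPdist_le _ _ _ \oo)/(_ d d0) [m _ /(_ m.+1 (leqnSn m))] :=
    @cvg_geometric R B (1 - d) z1.
  rewrite /= sub0r normrN => h; exists m; exact: le_trans (ler_norm _) h.
pose f x := (1 - d) * damped d m x + 0.
have tf : torus_function f by apply: torus_function_affine; exact: damped_torus.
have fosc x y : f x - f y <= D by exact: damped_osc.
pose g := T f; have gE : g = damped d m.+1 by [].
have tg : torus_function g by exact: T_torus.
pose f' x := (1 - d) * g x + 0.
have tf' : torus_function f' by exact: torus_function_affine.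
pose w x := g x - g 0.
have tw : torus_function w.
  have -> : w = (fun x => 1 * g x + - g 0) by apply/funext => x; rewrite mul1r.
  exact: torus_function_affine.
exists w, (d * g 0); split => //.
- by rewrite /w subrr.
- by exists f.
have gosc x y : g x - g y <= D.
  have -> : D = D / 2 + C by rewrite /D; lra.
  exact: T_osc.
have dw x : - (d * D) <= d * w x <= d * D.
  have h1 : d * (g x - g 0) <= d * D by rewrite ler_pM2l.
  have h2 : d * (g 0 - g x) <= d * D by rewrite ler_pM2l.
  by rewrite /w; apply/andP; split; lra.
move=> x.
have h1 : T f' x <= T w x + ((1 - d) * g 0 + d * D).
  apply: T_mono => // y; have /andP[? ?] := dw y; move: (dw y).
  rewrite /f' /w => /andP[? ?]; lra.
have h2 : T w x <= T f' x + (- ((1 - d) * g 0) + d * D).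
  apply: T_mono => // y; move: (dw y).
  rewrite /f' /w => /andP[? ?]; lra.
have := Bm m.+1 x; rewrite -gE => /le_trans/(_ mB).
rewrite (_ : damped d m.+2 x = T f' x)// ler_norml => /andP[h3 h4].
rewrite ler_norml /w; apply/andP; split; lra.
Qed.

(** A uniform limit [v] of approximate eigenfunctions: [T v - v] is within
    [6 * e] of its value at the origin, for every [e]. *)
Lemma additive_eigenfunction :
  exists v l, torus_function v /\ forall x, T v x = v x + l.
Proof.
have ex k := @approximate_eigenfunction (k.+1%:R^-1)
  (etrans (invr_gt0 _) (ltr0Sn R k)).
have [w wP] := choice ex.
have [L L0 TL] := T_lipschitz (2 * C).
have Lw k : lipschitz_with L (w k).
  have [l [_ _ [f [tf fosc] ->] _]] := wP k => x y.
  by rewrite opprB addrA subrK; exact: TL.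
have [||v [pv Lv wv]] := @equilipschitz_limit w L L0 _ Lw.
- by move=> k; have [l [[]]] := wP k.
- by move=> k; have [l []] := wP k.
have tv : torus_function v by split=> //; exact: lipschitz_continuous Lv.
exists v, (T v 0 - v 0); split => // x; apply/eqP; rewrite -subr_eq0.
have near_eig e : 0 < e -> `|T v x - (v x + (T v 0 - v 0))| <= 6 * e.
  move=> e0; have [k [mk wk]] := wv e (Num.truncn e^-1) e0.
  have [l [tw _ _ eig]] := wP k.
  have ke : k.+1%:R^-1 <= e.
    rewrite -[leRHS]invrK lef_pV2 ?posrE ?invr_gt0 ?ltr0n//; apply: ltW.
    have /andP[_ h] := Num.Theory.truncn_itv (ltW (etrans (invr_gt0 e) e0)).
    by apply: lt_le_trans h _; rewrite ler_nat ltnS.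
  have Twv := T_nonexpansive tw tv wk.
  have bound y : `|T v y - v y - l| <= 3 * e.
    have := le_trans (eig y) ke; have := Twv y; have := wk y; rewrite !ler_norml.
    move=> /andP[? ?] /andP[? ?] /andP[? ?]; apply/andP; split; lra.
  have := bound x; have := bound 0; rewrite !ler_norml.
  by move=> /andP[? ?] /andP[? ?]; apply/andP; split; lra.
rewrite -normr_le0; apply/ler_addgt0Pl => e e0; rewrite addr0.
have := near_eig (e / 6) (divr_gt0 e0 (ltr0Sn _ _)).
by have -> : 6 * (e / 6) = e by lra.
Qed.

End Operator.
End Eigenfunction.

(** * The coupled system *)

Section System.
Context {R : realType} {n : nat}.
Implicit Types (x p : 'rV[R]_n) (H : 'rV[R]_n -> 'rV[R]_n -> R).

(** The value of [G] for which [T f] oscillates at most by [D / 4 + C] when [f]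
    oscillates by [D], the unit cube having Euclidean diameter [sqrt n]. *)
Let G : R := 4 * Num.sqrt n%:R.

Lemma smooth_jointly_continuous H : smooth_hamiltonian H -> jointly_continuous H.
Proof. by case=> _ /(_ 0%N). Qed.

Lemma smooth_differentiable H x p : smooth_hamiltonian H ->
  differentiable (fun y => H y p) x.
Proof.
case=> _ /(_ 1%N)[dH _].
apply: (@differentiable_comp _ _ _ _ (fun y => (y, p)) (fun xp => H xp.1 xp.2)).
  by apply: differentiable_pair.
exact: dH.
Qed.

(** The limit hypothesis is a Riccati inequality for [H] along the lines
    [x + t *: p], which forces [|H| >= G * c * |p|] for large [p] with a constant
    sign; a Hamiltonian tending to minus infinity is reflected. *)
Lemma solution_operator_exists (c omega : R) H : (2 <= n)%N -> 0 < c -> 0 < omega ->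
  smooth_hamiltonian H ->
  lim_pinfty_unif (fun x p : 'rV[R]_n =>
    omega * `|H x p| ^+ 2 + dotp (grad (fun y => H y p) x) p
    - 16 * n%:R * omega * c ^+ 2 * enorm p ^+ 2) ->
  exists T, solution_operator c G H T.
Proof.
move=> n2 c0 w0 sH lim.
have G0 : 0 < G by rewrite mulr_gt0// sqrtr_gt0 ltr0n (leq_trans _ n2).
have cH := smooth_jointly_continuous sH.
have pH : forall p, zperiodic (fun x => H x p) by case: sH.
have [r Hr] := lim 0; pose r' := Num.max 0 r.
have r'0 : 0 <= r' by rewrite le_max lexx.
have k0 : 0 < G * c by rewrite mulr_gt0.
have ric x p : r' < enorm p ->
    omega * (G * c * enorm p) ^+ 2 < omega * H x p ^+ 2 + 'D_p (fun y => H y p) x.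
  rewrite gt_max => /andP[_ /(Hr x)].
  rewrite real_normK ?num_real// derive_grad; last exact: smooth_differentiable.
  have -> : (G * c * enorm p) ^+ 2 = 16 * n%:R * c ^+ 2 * enorm p ^+ 2.
    by rewrite !exprMn sqr_sqrtr ?ler0n//; ring.
  by lra.
have dH x p := @smooth_differentiable H x p sH.
have thr := threshold w0 k0 cH pH dH ric.
have sgn := sign_constant w0 k0 r'0 cH pH dH ric n2.
have [[x0 [p0 [rp0 Hpos]]]|nopos] :=
    pselect (exists x p, r' < enorm p /\ 0 < H x p).
  apply: solution_operator_coercive => //; exists r' => x p rp.
  have Hxp : 0 < H x p by rewrite (sgn _ _ x0 p0).
  by have := thr x p rp; rewrite gtr0_norm.
have [|||T TP] := @solution_operator_coercive _ _ c G (fun x p => - H x (- p)) c0 G0.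
- move=> xp; apply: continuousN.
  apply: (@continuous_comp _ _ _ (fun xp : 'rV[R]_n * 'rV[R]_n => (xp.1, - xp.2))
    (fun xp => H xp.1 xp.2)); last exact: cH.
  apply: (@cvg_pair _ _ _ (nbhs xp) (nbhs xp.1) (nbhs (- xp.2))); first exact: cvg_fst.
  by apply: (@cvgN _ _ _ (nbhs xp)); exact: cvg_snd.
- by move=> p x z; rewrite pH.
- exists r' => x p; rewrite -(enormN p) => rp.
  have Hxp : H x (- p) <= 0.
    by rewrite leNgt; apply/negP => Hxp; apply: nopos; exists x, (- p).
  by have := thr x (- p) rp; rewrite ler0_norm.
- by exists (fun f => - T (- f)); exact: solution_operator_reflect.
Qed.

Lemma solution_operator_torus (c : R) H T f : solution_operator c G H T ->
  torus_function f -> torus_function (T f).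
Proof. by case=> Tsol _ _ [cf pf]; have [pT [cT _ _]] := Tsol f cf pf. Qed.

Lemma solution_operator_osc (c : R) H T : (0 < n)%N -> solution_operator c G H T ->
  exists2 C, 0 <= C & forall f (D : R), torus_function f ->
    (forall x y, f x - f y <= D) -> forall x y, T f x - T f y <= D / 4 + C.
Proof.
move=> n0 ST; have [_ _ [C C0 TC]] := ST.
have sn0 : 0 < Num.sqrt n%:R :> R by rewrite sqrtr_gt0 ltr0n.
exists (C * Num.sqrt n%:R) => [|f D tf fD]; first by rewrite mulr_ge0// sqrtr_ge0.
have D0 : 0 <= D by have := fD 0 0; rewrite subrr.
have [cf pf] := tf; have [_ pT] := solution_operator_torus ST tf.
apply: (zperiodic_osc _ pT (TC f D cf pf fD)).
  by rewrite addr_ge0// divr_ge0// mulr_ge0// ltW.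
rewrite mulrDl lerD2r /G.
suff -> : D / (4 * Num.sqrt n%:R) * Num.sqrt n%:R = D / 4 by [].
by field; rewrite gt_eqF.
Qed.

Lemma eigenfunction_composition (c1 c2 : R) H1 H2 T1 T2 : (0 < n)%N ->
  solution_operator c1 G H1 T1 -> solution_operator c2 G H2 T2 ->
  exists v l, torus_function v /\ forall x, T2 (T1 v) x = v x + l.
Proof.
move=> n0 S1 S2.
have [C1 C10 osc1] := solution_operator_osc n0 S1.
have [C2 C20 osc2] := solution_operator_osc n0 S2.
have [_ mono1 _] := S1; have [_ mono2 [K2 K20 lip2]] := S2.
have t1 f := @solution_operator_torus c1 H1 T1 f S1.
have t2 f := @solution_operator_torus c2 H2 T2 f S2.
apply: (@additive_eigenfunction _ _ (fun f => T2 (T1 f)) (C1 + C2)).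
- by move=> f tf; apply/t2/t1.
- move=> f g k tf tg fg; have [cf pf] := tf; have [cg pg] := tg.
  have [cf1 pf1] := t1 f tf; have [cg1 pg1] := t1 g tg.
  by apply: mono2 => //; exact: mono1.
- exact: addr_ge0.
- move=> f D tf fD x y.
  have D0 : 0 <= D by have := fD 0 0; rewrite subrr.
  have := osc2 _ _ (t1 f tf) (osc1 f D tf fD) x y; lra.
- move=> D; pose L := (D / 4 + C1) / G + K2.
  exists (Num.max 0 L); first by rewrite le_max lexx.
  move=> f tf fD x y; have [cf1 pf1] := t1 f tf.
  apply: le_trans (lip2 _ _ cf1 pf1 (osc1 f D tf fD) x y) _.
  by rewrite ler_wpM2r ?enorm_ge0// le_max lexx orbT.
Qed.

End System.

Theorem theorem1p2 (R : realType) (n : nat) (hn : (2 <= n)%N)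
  (c1 c2 : R) (hc1 : 0 < c1) (hc2 : 0 < c2)
  (H1 H2 : 'rV[R]_n -> 'rV[R]_n -> R)
  (hH1 : smooth_hamiltonian H1) (hH2 : smooth_hamiltonian H2)
  (hlim : exists omega1 omega2 : R,
    [/\ 0 < omega1, 0 < omega2,
        lim_pinfty_unif (fun x p : 'rV[R]_n =>
          omega1 * `|H1 x p| ^+ 2 + dotp (grad (fun y => H1 y p) x) p
          - 16 * n%:R * omega1 * c1 ^+ 2 * enorm p ^+ 2)
      & lim_pinfty_unif (fun x p : 'rV[R]_n =>
          omega2 * `|H2 x p| ^+ 2 + dotp (grad (fun y => H2 y p) x) p
          - 16 * n%:R * omega2 * c2 ^+ 2 * enorm p ^+ 2)]) :
  exists Hbar1 Hbar2 : R, exists u1 u2 : 'rV[R]_n -> R,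
    [/\ zperiodic u1, zperiodic u2
      & visc_solution_system c1 c2 H1 H2 Hbar1 Hbar2 u1 u2].
Proof.
have [w1 [w2 [w10 w20 lim1 lim2]]] := hlim.
have [T1 S1] := solution_operator_exists hn hc1 w10 hH1 lim1.
have [T2 S2] := solution_operator_exists hn hc2 w20 hH2 lim2.
have n0 : (0 < n)%N by exact: leq_trans hn.
have [v [l [tv vl]]] := eigenfunction_composition n0 S1 S2.
have [cv pv] := tv; have [cu pu] := solution_operator_torus S1 tv.
have [Tsol1 _ _] := S1; have [Tsol2 _ _] := S2.
have [_ sol1] := Tsol1 v cv pv; have [_ [_ sub2 sup2]] := Tsol2 (T1 v) cu pu.
exists 0, (- (c2 * l)), (T1 v), v; split=> //; split.
  have -> : (fun x r p => c1 * r - c1 * v x + H1 x p - 0) =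
      discounted c1 (fun x p => H1 x p - c1 * v x).
    by apply/funext => x; apply/funext => r; apply/funext => p; rewrite /discounted; lra.
  exact: sol1.
(* the additive eigenvalue is absorbed by the second constant *)
have {}vl : T2 (T1 v) = fun x => v x + l by exact/funext.
rewrite vl in sub2 sup2.
split=> // phi x Cphi vphi.
  have : c2 * (v x + l) + (H2 x (grad phi x) - c2 * T1 v x) <= 0.
    by apply: sub2 => //; apply: filterS vphi => y; lra.
  by lra.
have : 0 <= c2 * (v x + l) + (H2 x (grad phi x) - c2 * T1 v x).
  by apply: sup2 => //; apply: filterS vphi => y; lra.
by lra.
Qed.
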